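(* Let $A=\{0,1\}$ be the binary alphabet, let $W_0$ be a finite (possibly empty) word over $A$, and let $\boldsymbol\varepsilon=(\varepsilon_i)_{i\ge0}$ be a periodic sequence with values in $A$, of period $n\ge1$. Let $\mathbf u=\mathcal P(W_0,\boldsymbol\varepsilon)$. Then for all $k\ge1$, the continued fraction $\mathrm{CF}(\sigma^k(\mathbf u))$ is algebraic over $\mathbb F_2(A)$ of degree at most $2^n$.
   Context: The family $\mathcal P$: given a finite word $W_0$ over $A$ and a periodic sequence $\boldsymbol\varepsilon=(\varepsilon_i)_{i\ge0}$ in $A$ (period $n$ means $\varepsilon_{i+n}=\varepsilon_i$ for all $i\ge0$), define words by $W_{i+1}=W_i\,\varepsilon_i\,W_i$ (concatenation). Each $W_i$ is a prefix of $W_{i+1}$; $\mathcal P(W_0,\boldsymbol\varepsilon)$ denotes the infinite sequence $\lim_i W_i$. The operator $\sigma$ maps a binary sequence $(u_i)_{i\ge0}$ to the binary sequence $\left(\sum_{j=0}^{i-1}u_j \bmod 2\right)_{i\ge0}$ (so its first term is $0$); $\sigma^k$ is its $k$-fold iterate. When $\sigma$ is applied, the terms are regarded as the numbers $0$ and $1$; when the continued fraction is formed, the two letters $0$ and $1$ are regarded as two independent formal variables $a_0$ and $a_1$ over the field $\mathbb F_2$. Put $\mathbb F_2[A]=\mathbb F_2[a_0,a_1]$, $\mathbb F_2(A)=\mathbb F_2(a_0,a_1)$, and let $\mathbb F_2((A))$ be the ring of power series of the form $\varphi=\sum_{n_0,n_1\ge N}c_{n_0,n_1}a_0^{-n_0}a_1^{-n_1}$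 with $N\in\mathbb Z$ (depending on $\varphi$) and $c_{n_0,n_1}\in\mathbb F_2$. It contains $\mathbb F_2[A]$ and is an integral domain. The valuation is $\mathrm{val}(\varphi)=\min\{n_0+n_1: c_{n_0,n_1}\ne0\}$ (with $\min\emptyset=\infty$), and the norm of $\varphi$ is $2^{-\mathrm{val}(\varphi)}$; convergence is with respect to this norm. For a sequence $(x_i)_{i\ge0}$ in $A$, set $[x_0]=x_0$ and $[x_0,\dots,x_m]=x_0+1/[x_1,\dots,x_m]\in\mathbb F_2((A))$ for $m\ge1$; $\mathrm{CF}((x_i)_i)$ is the limit of $([x_0,\dots,x_m])_m$ in $\mathbb F_2((A))$ (this limit always exists). ''Algebraic over $\mathbb F_2(A)$ of degree at most $D$'' means being a root of a nonzero one-variable polynomial of degree at most $D$ with coefficients in $\mathbb F_2(A)$ (equivalently, after clearing denominators, in $\mathbb F_2[A]$). *)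

(* Defs.v *)
From HB Require Import structures.
From mathcomp Require Import all_boot all_order all_algebra.
From mathcomp Require Import boolp classical_sets functions cardinality fsbigop.
From mathcomp Require Import mpoly.
From mathcomp Require Import zify.

Set Implicit Arguments.
Unset Strict Implicit.
Unset Printing Implicit Defensive.

Import Order.TTheory GRing.Theory Num.Theory.
Local Open Scope classical_set_scope.
Local Open Scope ring_scope.

(* [phi (n0, n1)] is the coefficient of a_0 ^ (- n0) * a_1 ^ (- n1). *)
Definition bounded_below (f : int * int -> 'F_2) : Prop :=
  exists N : int, forall n, f n != 0 -> N <= n.1 /\ N <= n.2.

Definition is_laurent : {pred int * int -> 'F_2} :=
  fun f => `[< bounded_below f >].

Record laurent := Laurent {
  coef :> int * int -> 'F_2;
  _ : coef \in is_laurent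
}.

HB.instance Definition _ := [isSub for coef].
HB.instance Definition _ := [Choice of laurent by <:].

Lemma is_laurentP f : reflect (bounded_below f) (f \in is_laurent).
Proof. exact: asboolP. Qed.

Lemma laurentP (phi : laurent) : bounded_below phi.
Proof. exact/is_laurentP/(valP phi). Qed.

Lemma eq_laurent (phi psi : laurent) : (phi =1 psi) -> phi = psi.
Proof. by move=> h; apply/val_inj/funext. Qed.

Fact is_laurent_zmod : zmod_closed is_laurent.
Proof.
split=> [|f g /is_laurentP[N hN] /is_laurentP[M hM]]; apply/is_laurentP.
  by exists 0 => n; rewrite eqxx.
exists (Num.min N M) => n; have [f0|/hN[]] := eqVneq (f n) 0; last by lia.
have [g0|/hM[]] := eqVneq (g n) 0; last by lia.
by rewrite /GRing.add /= /GRing.opp /= f0 g0 subr0 eqxx.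
Qed.

HB.instance Definition _ := GRing.isZmodClosed.Build _ is_laurent is_laurent_zmod.
HB.instance Definition _ := [SubChoice_isSubZmodule of laurent by <:].

Lemma coefD (phi psi : laurent) n : (phi + psi) n = phi n + psi n.
Proof. by []. Qed.
Lemma coefN (phi : laurent) n : (- phi) n = - phi n.
Proof. by []. Qed.
Lemma coefB (phi psi : laurent) n : (phi - psi) n = phi n - psi n.
Proof. by []. Qed.
Lemma coef0 n : (0 : laurent) n = 0.
Proof. by []. Qed.

(* Finitely supported sums: on Laurent series only finitely many summands are
   nonzero, see [convE]. *)
Definition conv (f g : int * int -> 'F_2) : int * int -> 'F_2 :=
  fun m => \sum_(i \in [set: int * int]) f i * g (m - i).

Definition box (K : int) : set (int * int) :=
  [set i | [/\ - K <= i.1, i.1 <= K, - K <= i.2 & i.2 <= K]].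

Lemma finite_box K : finite_set (box K).
Proof.
pose g (i : nat * nat) : int * int := (i.1%:Z - K, i.2%:Z - K).
have fin : finite_set (g @` (`I_((absz K).*2.+1) `*` `I_((absz K).*2.+1))).
  by apply: finite_image; apply: finite_setX; apply: finite_II.
apply: sub_finite_set fin => -[i j] [/= h1 h2 h3 h4].
exists (absz (i + K), absz (j + K)); first by split=> /=; lia.
by rewrite /g /=; congr pair; lia.
Qed.

Lemma sum_box K (F : int * int -> 'F_2) :
  (forall i, F i != 0 -> box K i) ->
  \sum_(i \in [set: int * int]) F i = \sum_(i \in box K) F i.
Proof.
move=> h; apply/esym/fsbig_widen => // i [_ /= nb].
by apply/eqP; apply: contra_notT nb => /h.
Qed.

Lemma conv_box f g m : bounded_below f -> bounded_below g ->
  exists K0 : int, forall K, K0 <= K ->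
    forall i, f i * g (m - i) != 0 -> box K i.
Proof.
move=> [N hN] [M hM]; exists (`|N| + `|M| + `|m.1| + `|m.2|) => K hK [i j].
rewrite mulf_eq0 negb_or => /andP[/hN[/= h1 h2] /hM[/= h3 h4]].
by case: m hK h3 h4 => m0 m1 /= *; split => /=; lia.
Qed.

Lemma convE f g m : bounded_below f -> bounded_below g ->
  exists K0 : int, forall K, K0 <= K ->
    conv f g m = \sum_(i \in box K) f i * g (m - i).
Proof.
move=> hf hg; have [K0 h] := conv_box m hf hg.
by exists K0 => K /h hK; apply: sum_box.
Qed.

Lemma conv_bound f g N M :
  (forall n, f n != 0 -> N <= n.1 /\ N <= n.2) ->
  (forall n, g n != 0 -> M <= n.1 /\ M <= n.2) ->
  forall n, conv f g n != 0 -> N + M <= n.1 /\ N + M <= n.2.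
Proof.
move=> hN hM n.
case: (pselect (exists i, f i * g (n - i) != 0)) => [[i]|nex].
  rewrite mulf_eq0 negb_or => /andP[/hN[h1 h2] /hM[h3 h4]] _.
  by case: n i h1 h2 h3 h4 => n0 n1 [i j] /=; lia.
rewrite /conv fsbig1 ?eqxx // => i _; apply/eqP.
by apply: contra_notT nex => h; exists i.
Qed.

Fact conv_laurent (phi psi : laurent) : conv phi psi \in is_laurent.
Proof.
have [N hN] := laurentP phi; have [M hM] := laurentP psi.
by apply/is_laurentP; exists (N + M); apply: conv_bound.
Qed.

Definition mul_laurent (phi psi : laurent) : laurent :=
  Laurent (conv_laurent phi psi).

(* The monomial a_0 ^ (- e.1) * a_1 ^ (- e.2). *)
Fact monom_laurent (e : int * int) :
  (fun n => (n == e)%:R : 'F_2) \in is_laurent.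
Proof.
apply/is_laurentP; exists (Num.min e.1 e.2) => n.
by case: (eqVneq n e) => [->|]; rewrite ?eqxx //= => _; split; lia.
Qed.

Definition monom (e : int * int) : laurent := Laurent (monom_laurent e).

Lemma sum1_box (F : int * int -> 'F_2) e :
  (forall i, i != e -> F i = 0) -> \sum_(i \in [set: int * int]) F i = F e.
Proof.
move=> h; rewrite -(fsbig_widen [set e] setT) ?fsbig_set1 //.
by move=> i [_ /= /eqP]; apply: h.
Qed.

Lemma coef_monomM e (phi : laurent) n : mul_laurent (monom e) phi n = phi (n - e).
Proof.
rewrite /= /conv (@sum1_box _ e) /= ?eqxx ?mul1r //.
by move=> i /negPf ->; rewrite mul0r.
Qed.

Fact mul_laurentC : commutative mul_laurent.
Proof.
move=> phi psi; apply: eq_laurent => m /=; rewrite /conv.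
rewrite (reindex_fsbigT (fun i => m - i)); last first.
  by exists (fun i => m - i) => i; rewrite subKr.
by apply: eq_fsbigr => i _; rewrite subKr mulrC.
Qed.

Fact mul_laurentA : associative mul_laurent.
Proof.
move=> f g h; apply: eq_laurent => m /=.
have [K1 E1] := convE m (laurentP f) (laurentP (mul_laurent g h)).
have [K2 E2] := convE m (laurentP (mul_laurent f g)) (laurentP h).
have [N hN] := laurentP f; have [N' hN'] := laurentP g.
have [N'' hN''] := laurentP h.
pose K : int := `|K1| + `|K2| + `|N| + `|N'| + `|N''| + `|m.1| + `|m.2|.
rewrite (E1 K) ?(E2 K) /=; try by rewrite /K; lia.
transitivity
  (\sum_(l \in box K) \sum_(i \in box K) f i * g (l - i) * h (m - l)); last first.
  apply: eq_fsbigr => l; rewrite inE => hl.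
  have [hml|hml] := eqVneq (h (m - l)) 0.
    by rewrite hml mulr0 fsbig1 // => i _; rewrite mulr0.
  rewrite -mulr_fsuml; congr (_ * _); apply/esym/sum_box => i.
  rewrite mulf_eq0 negb_or => /andP[/hN[h1 h2] /hN'[h3 h4]].
  have [h5 h6] := hN'' _ hml.
  move: h1 h2 h3 h4 h5 h6; rewrite /K; clear; case: m l i => m0 m1 [l0 l1] [i j] /=.
  by move=> *; split => /=; lia.
rewrite exchange_fsbig; try exact: finite_box.
apply: eq_fsbigr => i; rewrite inE => hi.
have [->|fi] := eqVneq (f i) 0.
  by rewrite mul0r fsbig1 // => j _; rewrite !mul0r.
rewrite /conv mulr_fsumr.
rewrite (reindex_fsbigT (fun l => l - i)); last first.
  by exists (fun l => l + i) => l; rewrite ?subrK ?addrK.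
rewrite (@sum_box K).
  by apply: eq_fsbigr => l _; rewrite mulrA opprB addrA subrK.
move=> l; rewrite !mulf_eq0 !negb_or => /and3P[_ /hN'[h1 h2] /hN''[h3 h4]].
have [h5 h6] := hN _ fi.
move: h1 h2 h3 h4 h5 h6; rewrite /K; clear; case: m l i => m0 m1 [l0 l1] [i j] /=.
by move=> *; split => /=; lia.
Qed.

Fact mul_1laurent : left_id (monom 0) mul_laurent.
Proof. by move=> phi; apply: eq_laurent => n; rewrite coef_monomM subr0. Qed.

Fact mul_laurentDl : left_distributive mul_laurent +%R.
Proof.
move=> f g h; apply: eq_laurent => m; rewrite coefD /=.
have [K1 E1] := convE m (laurentP f) (laurentP h).
have [K2 E2] := convE m (laurentP g) (laurentP h).
have [K3 E3] := convE m (laurentP (f + g)) (laurentP h).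
pose K : int := `|K1| + `|K2| + `|K3|.
rewrite (E1 K) ?(E2 K) ?(E3 K) /=; try by rewrite /K; lia.
rewrite -fsbig_split; last exact: finite_box.
by apply: eq_fsbigr => i _; exact: mulrDl.
Qed.

Fact laurent1_neq0 : monom 0 != 0 :> laurent.
Proof. by apply/eqP => /(congr1 (fun p : laurent => p 0)) /eqP. Qed.

HB.instance Definition _ := GRing.Zmodule_isComNzRing.Build laurent
  mul_laurentA mul_laurentC mul_1laurent mul_laurentDl laurent1_neq0.

Definition laurent_unit : {pred laurent} :=
  fun phi => `[< exists psi, psi * phi = 1 >].

Definition laurent_inv (phi : laurent) : laurent :=
  if pselect (exists psi, psi * phi = 1) is left h then projT1 (cid h) else phi.

Fact laurent_mulVr : {in laurent_unit, left_inverse 1 laurent_inv *%R}.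
Proof.
move=> phi /asboolP h; rewrite /laurent_inv; case: pselect => // h'.
exact: projT2 (cid h').
Qed.

Fact laurent_unitP phi psi : psi * phi = 1 -> laurent_unit phi.
Proof. by move=> h; apply/asboolP; exists psi. Qed.

Fact laurent_invr_out : {in [predC laurent_unit], laurent_inv =1 id}.
Proof.
move=> phi; rewrite inE => /asboolP h.
by rewrite /laurent_inv; case: pselect.
Qed.

HB.instance Definition _ := GRing.ComNzRing_hasMulInverse.Build laurent
  laurent_mulVr laurent_unitP laurent_invr_out.

Lemma laurentM_coef (phi psi : laurent) m : (phi * psi) m = conv phi psi m.
Proof. by []. Qed.

Lemma laurent1E : (1 : laurent) = monom 0. Proof. by []. Qed.

Lemma monomM e (phi : laurent) n : (monom e * phi) n = phi (n - e).
Proof. exact: coef_monomM. Qed.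

Lemma monomD e f : monom e * monom f = monom (e + f).
Proof.
by apply: eq_laurent => n; rewrite monomM /= subr_eq addrC.
Qed.

Lemma monomX e k : monom e ^+ k = monom (e *+ k).
Proof. by elim: k => // k IH; rewrite exprS IH monomD mulrS. Qed.

(* The letters as formal variables: [false] is a_0 and [true] is a_1. *)
Definition letter (b : bool) : laurent :=
  monom (if b then (0, -1) else (-1, 0)).

Fact constant_laurent (c : 'F_2) :
  (fun n : int * int => if n == 0 then c else 0) \in is_laurent.
Proof.
by apply/is_laurentP; exists 0 => n; have [->|] := eqVneq n 0; rewrite ?eqxx.
Qed.

Definition constant (c : 'F_2) : laurent := Laurent (constant_laurent c).

Lemma coef_constantM c (phi : laurent) n : (constant c * phi) n = c * phi n.
Proof.
rewrite laurentM_coef /conv (@sum1_box _ 0) /= ?subr0 //.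
by move=> i /negPf ->; rewrite mul0r.
Qed.

Fact constant_zmod_morphism : zmod_morphism constant.
Proof.
move=> c d; apply: eq_laurent => n; rewrite coefB /=.
by case: ifP; rewrite ?subr0.
Qed.

HB.instance Definition _ :=
  GRing.isZmodMorphism.Build 'F_2 laurent constant constant_zmod_morphism.

Fact constant_monoid_morphism : monoid_morphism constant.
Proof.
split=> [|c d]; apply: eq_laurent => n; first by rewrite /=; case: eqP.
by rewrite coef_constantM /=; case: ifP; rewrite ?mulr0.
Qed.

HB.instance Definition _ :=
  GRing.isMonoidMorphism.Build 'F_2 laurent constant constant_monoid_morphism.

(* F_2[a_0, a_1] inside F_2((A)). *)
Definition embed : {mpoly 'F_2[2]} -> laurent :=
  mmap constant (fun i : 'I_2 => letter (i == 1)).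

HB.instance Definition _ := GRing.RMorphism.on embed.

Lemma coef_embed (p : {mpoly 'F_2[2]}) (m : 'X_{1..2}) :
  embed p (- (m 0)%:Z, - (m 1)%:Z) = p@_m.
Proof.
have mm (k : 'X_{1..2}) : mmap1 (fun i : 'I_2 => letter (i == 1)) k
    = monom (- (k 0)%:Z, - (k 1)%:Z).
  rewrite /mmap1 big_ord_recl big_ord1 /=.
  have -> : lift ord0 ord0 = 1 :> 'I_2 by apply/val_inj.
  rewrite /letter /= !monomX monomD; congr monom.
  rewrite !pairMnE /= !mul0rn.
  rewrite !mulNrn !natz.
  by apply: injective_projections; rewrite /= ?addr0 ?add0r.
have sumE (r : seq 'X_{1..2}) (G : 'X_{1..2} -> laurent) n :
    (\sum_(k <- r) G k) n = \sum_(k <- r) G k n.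
  by elim: r => [|k r IH]; rewrite ?big_nil // !big_cons coefD IH.
rewrite /embed /mmap sumE.
have eqk (k : 'X_{1..2}) :
    ((- (m 0)%:Z, - (m 1)%:Z) == (- (k 0)%:Z, - (k 1)%:Z)) = (m == k).
  apply/eqP/eqP => [[h0 h1]|-> //]; apply/mnmP => i.
  have : (i == 0) || (i == 1) by case: i => [[|[|]]].
  by case/orP => /eqP ->; lia.
under eq_bigr => k _ do rewrite mm coef_constantM /= eqk.
have [ms|ms] := boolP (m \in msupp p); last first.
  rewrite (memN_msupp_eq0 ms) big1_seq // => k /= kp.
  by case: eqP => [mk|_]; rewrite ?mulr0 // -mk in kp *; rewrite kp in ms.
rewrite (bigD1_seq m) ?msupp_uniq //= eqxx mulr1 big1 ?addr0 // => k.
by rewrite eq_sym => /negPf ->; rewrite mulr0.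
Qed.

Lemma embed_inj : injective embed.
Proof. by move=> p q h; apply/mpolyP => m; rewrite -!coef_embed h. Qed.

Definition total_degrees (phi : laurent) : set int :=
  [set d | exists2 n, phi n != 0 & d = n.1 + n.2].

Definition is_valuation (phi : laurent) (d : int) : Prop :=
  total_degrees phi d /\ lbound (total_degrees phi) d.

Lemma valuation_exists (phi : laurent) :
  phi != 0 -> exists d, is_valuation phi d.
Proof.
move=> phi0; have [N hN] := laurentP phi.
have [n0 hn0] : exists n, phi n != 0.
  apply/not_existsP => h; case/eqP: phi0; apply: eq_laurent => n.
  by rewrite coef0; apply/eqP; apply: contra_notT (h n).
pose P k := `[< exists2 n, phi n != 0 & n.1 + n.2 = N *+ 2 + k%:Z >].
have exP : exists k, P k.
  exists (absz (n0.1 + n0.2 - N *+ 2)%R); apply/asboolP; exists n0 => //.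
  by have [] := hN _ hn0; lia.
have [k /asboolP[n hn hk] kmin] := ex_minnP exP.
exists (n.1 + n.2); split; first by exists n.
move=> _ [i hi ->].
suff /kmin : P (absz (i.1 + i.2 - N *+ 2)%R) by have [] := hN _ hi; lia.
by apply/asboolP; exists i => //; have [] := hN _ hi; lia.
Qed.

Lemma is_valuation_unique phi d e :
  is_valuation phi d -> is_valuation phi e -> d = e.
Proof. by move=> [hd ld] [he le]; apply/le_anti; rewrite ld // le. Qed.

(* [None] stands for the value infinity of the zero series. *)
Definition valuation (phi : laurent) : option int :=
  if pselect (exists d, is_valuation phi d) is left h
  then Some (projT1 (cid h)) else None.

Lemma valuation_Some phi d : valuation phi = Some d <-> is_valuation phi d.
Proof.
rewrite /valuation; case: pselect => [h|nh]; last first.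
  by split=> // h; case: nh; exists d.
split=> [[<-]|hd]; first exact: projT2 (cid h).
by congr Some; apply: is_valuation_unique (projT2 (cid h)) hd.
Qed.

Lemma valuation_None phi : valuation phi = None <-> phi = 0.
Proof.
rewrite /valuation; case: pselect => [h|nh]; split=> //.
  move=> p0; have [d [[n + _] _]] := h; have -> : phi n = 0 by rewrite p0.
  by rewrite eqxx.
by move=> _; have [//|/valuation_exists] := eqVneq phi 0.
Qed.

Definition norm (phi : laurent) : rat :=
  if valuation phi is Some d then 2%:Q ^ (- d) else 0.

(* The norm takes rational values, so rational bounds [e] suffice. *)
Definition converges (u : nat -> laurent) (phi : laurent) : Prop :=
  forall e : rat, 0 < e ->
    exists M, forall m, (M <= m)%N -> norm (u m - phi) < e.

Lemma norm_le (phi : laurent) (d : int) : (forall n, phi n != 0 -> d <= n.1 + n.2) ->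
  norm phi <= 2%:Q ^ (- d).
Proof.
move=> h; rewrite /norm; case v: (valuation phi) => [e|]; last exact: exprz_ge0.
have [[n /h hn ->] _] := (valuation_Some _ _).1 v.
by rewrite ler_eXz2l //; lia.
Qed.

Lemma norm_lt (phi : laurent) (d : int) : norm phi < 2%:Q ^ (- d) ->
  forall n, phi n != 0 -> d < n.1 + n.2.
Proof.
rewrite /norm; case v: (valuation phi) => [e|] h n hn; last first.
  by move: hn; rewrite ((valuation_None _).1 v) coef0 eqxx.
have [_ le] := (valuation_Some _ _).1 v.
have : e <= n.1 + n.2 by apply: le; exists n.
by move: h; rewrite ltr_eXz2l //; lia.
Qed.

Lemma converges_unique u phi psi :
  converges u phi -> converges u psi -> phi = psi.
Proof.
move=> h1 h2; apply: eq_laurent => n; apply/eqP; rewrite -subr_eq0; apply/eqP.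
have pos : 0 < 2%:Q ^ (- (n.1 + n.2)) by exact: exprz_gt0.
have [M1 /(_ (maxn M1 _) (leq_maxl _ _)) H1] := h1 _ pos.
have [M2 H2] := h2 _ pos.
have {H1} e1 := norm_lt (H1 M2).
have {H2} e2 := norm_lt (H2 _ (leq_maxr M1 M2)).
have z1 : u (maxn M1 M2) n = phi n.
  apply/eqP; rewrite -subr_eq0 -coefB; apply/negP => /negP /e1.
  by rewrite ltxx.
have z2 : u (maxn M1 M2) n = psi n.
  apply/eqP; rewrite -subr_eq0 -coefB; apply/negP => /negP /e2.
  by rewrite ltxx.
by rewrite -z1 -z2 subrr.
Qed.

(* Series in a_0^-1, a_1^-1 all of whose monomials have total degree at least
   [d]: powers of the maximal ideal of F_2[[a_0^-1, a_1^-1]]. *)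
Definition small (d : nat) (phi : laurent) : Prop :=
  forall n, phi n != 0 -> [/\ 0 <= n.1, 0 <= n.2 & d%:Z <= n.1 + n.2].

Lemma small0 d : small d 0. Proof. by move=> n; rewrite coef0 eqxx. Qed.

Lemma small_leq d e phi : small e phi -> (d <= e)%N -> small d phi.
Proof. by move=> h de n /h[h1 h2 h3]; split => //; lia. Qed.

Lemma smallN d phi : small d phi -> small d (- phi).
Proof. by move=> h n; rewrite coefN oppr_eq0 => /h. Qed.

Lemma smallD d phi psi : small d phi -> small d psi -> small d (phi + psi).
Proof.
move=> h1 h2 n; rewrite coefD.
have [->|/h1 //] := eqVneq (phi n) 0.
by rewrite add0r => /h2.
Qed.

Lemma smallB d phi psi : small d phi -> small d psi -> small d (phi - psi).
Proof. by move=> h1 h2; apply: smallD => //; apply: smallN. Qed.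

Lemma smallM d e phi psi :
  small d phi -> small e psi -> small (d + e) (phi * psi).
Proof.
move=> h1 h2 n hn.
have [i] : exists i, phi i * psi (n - i) != 0.
  apply/not_existsP => h; move: hn; rewrite laurentM_coef /conv fsbig1 ?eqxx //.
  by move=> i _; apply/eqP; apply: contra_notT (h i).
rewrite mulf_eq0 negb_or => /andP[/h1[i1 i2 i3] /h2[]].
by case: n i i1 i2 i3 hn => n0 n1 [i j] /= *; split; lia.
Qed.

Lemma small1 : small 0 1.
Proof. by move=> n; rewrite laurent1E /=; have [->|] := eqVneq n 0; rewrite ?eqxx. Qed.

Lemma smallX phi k : small 1 phi -> small k (phi ^+ k).
Proof.
move=> h; elim: k => [|k IH]; first exact: small1.
by rewrite exprS -add1n; apply: smallM.
Qed.

Lemma small_eq0 phi : (forall d, small d phi) -> phi = 0.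
Proof.
move=> h; apply: eq_laurent => n; rewrite coef0; apply/eqP/negPn/negP.
by move=> /(h (absz (n.1 + n.2)).+1)[h1 h2 h3]; lia.
Qed.

Lemma small_complete (u : nat -> laurent) :
  (forall m, small 0 (u m)) -> (forall m, small m (u m.+1 - u m)) ->
  exists phi, forall m, small m (phi - u m).
Proof.
move=> u0 uS.
have uD m k : small m (u (m + k)%N - u m).
  elim: k => [|k IH]; first by rewrite addn0 subrr; apply: small0.
  rewrite addnS -(subrK (u (m + k)%N) (u _.+1)) -addrA.
  by apply: smallD => //; apply: small_leq (uS _) _; apply: leq_addr.
have uD' m k n : (m <= k)%N -> (n.1 + n.2 < m%:Z) -> u k n = u m n.
  move=> mk hn; apply/eqP; rewrite -subr_eq0 -coefB; apply/negPn/negP.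
  by rewrite -(subnKC mk) => /uD[_ _]; rewrite leNgt hn.
pose c (n : int * int) := u (absz (n.1 + n.2)).+1 n.
have hc : c \in is_laurent.
  by apply/is_laurentP; exists 0 => n /u0[].
exists (Laurent hc) => m n; rewrite coefB /= /c => hn.
have [n1 n2] : 0 <= n.1 /\ 0 <= n.2.
  have [z|/u0[] //] := eqVneq (u (absz (n.1 + n.2)).+1 n) 0.
  by move: hn; rewrite z sub0r oppr_eq0 => /u0[].
split=> //; rewrite leNgt; apply/negP => lt_n; case/eqP: hn.
rewrite (@uD' (absz (n.1 + n.2)).+1 m n) ?subrr //;
  by move: n1 n2 lt_n; clear; case: n => a b /=; lia.
Qed.

Lemma small_geometric psi :
  small 1 psi -> exists2 chi, small 0 chi & chi * (1 - psi) = 1.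
Proof.
move=> h; pose u m := \sum_(i < m) psi ^+ i.
have u0 m : small 0 (u m).
  rewrite /u; elim/big_ind: _ => [|a b|i _]; first exact: small0.
    exact: smallD.
  exact: small_leq (smallX h) _.
have uS m : small m (u m.+1 - u m).
  by rewrite /u big_ord_recr /= addrC addrK; apply: smallX.
have [chi hchi] := small_complete u0 uS.
exists chi; first by rewrite -[chi](subrK (u 0)); apply: smallD.
apply/eqP; rewrite -subr_eq0; apply/eqP/small_eq0 => d.
have uE : u d * (1 - psi) = 1 - psi ^+ d.
  by rewrite mulrC -[1 - psi ^+ d]opprB subrX1 -mulNr opprB.
have -> : chi * (1 - psi) - 1 = (chi - u d) * (1 - psi) - psi ^+ d.
  by rewrite mulrBl uE opprB addrA [_ + psi ^+ d - 1]addrAC addrK.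
apply: smallB; last exact: smallX.
have s1 : small 0 (1 - psi).
  by apply: smallB; [exact: small1 | apply: small_leq h _].
by have := smallM (hchi d) s1; rewrite addn0.
Qed.

Lemma letter_inv b : exists2 w, small 1 w & w * letter b = 1.
Proof.
exists (monom (if b then (0, 1) else (1, 0))); last first.
  by rewrite monomD laurent1E; congr monom; case: b.
case: b => n /=; first by have [->|] := eqVneq n (0, 1); rewrite ?eqxx.
by have [->|] := eqVneq n (1, 0); rewrite ?eqxx.
Qed.

Lemma letterD_unit b y : small 1 y ->
  letter b + y \is a GRing.unit /\ small 1 (letter b + y)^-1.
Proof.
move=> hy; have [w sw wl] := letter_inv b.
have swy : small 1 (- (w * y)).
  by apply: smallN; apply: small_leq (smallM sw hy) _.
have [chi schi hchi] := small_geometric swy.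
have eq1 : (chi * w) * (letter b + y) = 1.
  by rewrite -mulrA mulrDr wl -[w * y]opprK.
have un : letter b + y \is a GRing.unit by apply/unitrPr; exists (chi * w); rewrite mulrC.
split=> //; rewrite -[_^-1]mul1r -eq1 mulrK //.
by rewrite -[1%N]add0n; apply: smallM.
Qed.

(* [cfrac x m] is [x_0, ..., x_m]. *)
Fixpoint cfrac (x : nat -> bool) (m : nat) : laurent :=
  if m is m'.+1 then letter (x 0%N) + (cfrac (fun i => x i.+1) m')^-1
  else letter (x 0%N).

Lemma cfrac_unit_small x m :
  cfrac x m \is a GRing.unit /\ small 1 (cfrac x m)^-1.
Proof.
elim: m x => [|m IH] x /=; last exact/letterD_unit/(IH _).2.
by rewrite -[letter _]addr0; apply/letterD_unit/small0.
Qed.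

(* The divisions in a finite continued fraction are all defined. *)
Lemma cfrac_unit x m : cfrac x m \is a GRing.unit.
Proof. exact: (cfrac_unit_small x m).1. Qed.

Lemma cfracV_small x m : small m ((cfrac x m.+1)^-1 - (cfrac x m)^-1).
Proof.
elim: m x => [|m IH] x.
  by apply: smallB; apply: small_leq (cfrac_unit_small _ _).2 _.
have subV (a b : laurent) : a \is a GRing.unit -> b \is a GRing.unit ->
    a^-1 - b^-1 = (a^-1 * b^-1) * - (a - b).
  move=> ua ub; rewrite opprB mulrBr mulrVK //.
  by rewrite [a^-1 * _]mulrC mulrVK.
rewrite subV ?cfrac_unit //.
rewrite (_ : - _ = - ((cfrac (fun i => x i.+1) m.+1)^-1
                      - (cfrac (fun i => x i.+1) m)^-1)); last first.
  by congr (- _); rewrite /= opprD addrACA subrr add0r.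
apply: (@small_leq _ (1 + 1 + m)); last by rewrite addSn ltnW.
apply: smallM; last exact/smallN/IH.
by apply: smallM; apply: (cfrac_unit_small _ _).2.
Qed.

Lemma small_converges u phi :
  (forall m, small m (phi - u m.+1)) -> converges u phi.
Proof.
move=> h e e0; pose K := Num.bound e^-1.
have hK : 2%:Q ^ (- K%:Z) < e.
  rewrite -exprnN -[e]invrK ltf_pV2 ?posrE ?invr_gt0 ?exprn_gt0 //.
  apply: lt_trans (archi_boundP _) _; first by rewrite invr_ge0 ltW.
  by rewrite -natrX ltr_nat ltn_expl.
exists K.+1 => -[//|m] Km; apply: le_lt_trans hK; apply: norm_le => n hn.
have [] := h m n; last by lia.
by rewrite -opprB coefN oppr_eq0.
Qed.

Lemma cfrac_converges x : exists phi, converges (cfrac x) phi.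
Proof.
pose u m := (cfrac (fun i => x i.+1) m)^-1.
have [y hy] : exists y, forall m, small m (y - u m).
  apply: small_complete => m; last exact: cfracV_small.
  by apply: small_leq (cfrac_unit_small _ _).2 _.
exists (letter (x 0%N) + y); apply: small_converges => m /=.
by rewrite opprD addrACA subrr add0r; apply: hy.
Qed.

Definition CF (x : nat -> bool) : laurent := projT1 (cid (cfrac_converges x)).

Lemma CF_converges x : converges (cfrac x) (CF x).
Proof. exact: projT2 (cid (cfrac_converges x)). Qed.

(* Algebraic over F_2(a_0, a_1) of degree at most D: clearing denominators, the
   coefficients of the annihilating polynomial are taken in F_2[a_0, a_1]. *)
Definition algebraic_of_degree_le (D : nat) (phi : laurent) : Prop :=
  exists p : {poly {mpoly 'F_2[2]}},
    [/\ p != 0, (size p <= D.+1)%N & root (map_poly embed p) phi].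

(* [pword W0 eps i] is W_i. *)
Fixpoint pword (W0 : seq bool) (eps : nat -> bool) (i : nat) : seq bool :=
  if i is j.+1 then pword W0 eps j ++ eps j :: pword W0 eps j else W0.

(* W_(i+1) has more than i letters, and the words W_j extend each other. *)
Definition pseq (W0 : seq bool) (eps : nat -> bool) (i : nat) : bool :=
  nth false (pword W0 eps i.+1) i.

Lemma size_pword W0 eps i : (i <= size (pword W0 eps i))%N.
Proof. by elim: i => //= i IH; rewrite size_cat /=; lia. Qed.

Lemma pword_nth W0 eps i k j : (j < size (pword W0 eps i))%N ->
  nth false (pword W0 eps (i + k)) j = nth false (pword W0 eps i) j.
Proof.
move=> hj; elim: k => [|k IH]; first by rewrite addn0.
rewrite addnS /= nth_cat IH ifT //; apply: leq_trans hj _.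
by elim: k {IH} => [|k IH]; rewrite ?addn0 ?addnS //= size_cat; lia.
Qed.

Lemma pseq_prefix W0 eps i :
  mkseq (pseq W0 eps) (size (pword W0 eps i)) = pword W0 eps i.
Proof.
apply: (@eq_from_nth _ false); rewrite size_mkseq // => j hj.
rewrite nth_mkseq // /pseq; case: (leqP i j.+1) => ij.
  by rewrite -(subnKC ij) pword_nth.
by rewrite -[in RHS](subnKC (ltnW ij)) pword_nth // size_pword.
Qed.

(* Partial sums modulo 2; the letters are coerced to the numbers 0 and 1. *)
Definition sigma (u : nat -> bool) : nat -> bool :=
  fun i => odd (\sum_(j < i) u j).

(* Main.v *)
(* Put x = sigma^k(u) and L_i = (|W_0| + 1) 2^i. For i >= k the second half of
   the prefix of x of length 2 L_i is the first half, plus delta_i times a fixed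
   sequence whose period divides L_i. Hence the prefix V_i and its twist V'_i
   satisfy V_{i+1} = V_i V_i or V_i V'_i, according to delta_i, and symmetrically
   for V'_i; moreover delta_{i+1} = eps_i + eps_{i+1} has period n and even sum
   over a period.

   Let A_i, B_i be the continuant matrices of V_i, V'_i: they have determinant 1
   and, after the first nonzero delta_i, equal traces. Write A = A_0, B = B_0,
   t = tr A and E = 1 + (A + B) / t. In characteristic 2, Cayley-Hamilton gives
   E^2 = r with r = tr(AB) / t^2 a scalar, and, with s_i the parity of
   delta_0 + ... + delta_{i-1},
     A_i = (A + 1 + \sum_{j <= i} y_j E^(- s_j)) y_i^-1 E^(s_i),
     y_0 = 1,  y_{j+1} = y_j^2 / (t r^(s_j)).
   As s is n-periodic, y_{ln+j} = y_j y_{ln}^(2^j), so Y = \sum_l y_{ln} satisfies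
   Y = 1 + y_n Y^(2^n), and the first factor tends to
     S = A + 1 + \sum_{j < n} y_j Y^(2^j) E^(- s_j).
   Its columns are proportional to (CF(x), 1), so CF(x) is a quotient of two
   polynomials in Y with rational coefficients. *)
Require Import Defs.
From mathcomp Require Import all_boot all_order all_algebra.
From mathcomp Require Import boolp.
From mathcomp Require Import mpoly.
From mathcomp Require Import ring zify.

Set Implicit Arguments.
Unset Strict Implicit.
Unset Printing Implicit Defensive.

Import GRing.Theory.

(** * Self-similarity of the sequences sigma^k(u) *)

Lemma sigmaS (u : nat -> bool) i : sigma u i.+1 = sigma u i (+) u i.
Proof. by rewrite /sigma big_ord_recr oddD oddb. Qed.

Lemma mkseq_double (T : Type) (f g : nat -> T) L :
  (forall j, (j < L)%N -> f (j + L)%N = g j) ->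
  mkseq f (L + L) = mkseq f L ++ mkseq g L.
Proof.
move=> h; rewrite /mkseq iotaD map_cat; congr (_ ++ _).
rewrite add0n -[X in iota X]addn0 iotaDl -map_comp.
by apply/eq_in_map => j; rewrite mem_iota add0n /= addnC => /h.
Qed.

(** Summation is linear over F_2: splitting the partial sum at [L] turns the twist by [P] into a
    twist by its partial sums, up to the constant [sigma x L]. *)
Lemma sigma_shift (x P : nat -> bool) b L :
    (forall j, (j < L)%N -> x (j + L)%N = x j (+) (b && P j)) ->
  forall j, (j <= L)%N ->
    sigma x (j + L) = sigma x L (+) (sigma x j (+) (b && sigma P j)).
Proof.
have sigma0 z : sigma z 0 = false by rewrite /sigma big_ord0.
move=> h; elim=> [|j IH] jL; first by rewrite !sigma0 andbF !addbF.
rewrite addSn !sigmaS IH ?h //; last exact: ltnW.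
by case: b {h IH}; rewrite ?addbF -?addbA //=; congr (_ (+) (_ (+) _)); rewrite addbCA.
Qed.

(** Shifting by [T] adds the sum over one period, so shifting twice adds nothing modulo 2. *)
Lemma sigma_periodic_double (f : nat -> bool) T : (forall j, f (j + T)%N = f j) ->
  forall j, sigma f (j + (T + T)) = sigma f j.
Proof.
move=> h; have s j : sigma f (j + T) = sigma f T (+) sigma f j.
  elim: j => [|j IH]; first by rewrite /sigma big_ord0 addbF.
  by rewrite addSn !sigmaS IH h addbA.
by move=> j; rewrite addnA !s addbA addbb.
Qed.

(** The sequence is the binomial coefficient of j over k modulo 2; each summation doubles the
    period. *)
Lemma iter_sigma_periodic k j :
  iter k sigma (fun _ => true) (j + 2 ^ k) = iter k sigma (fun _ => true) j.
Proof.
elim: k j => [//|k IH] j; rewrite expnS mul2n -addnn; exact: sigma_periodic_double.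
Qed.

Lemma iter_sigma_periodic_mul k m j :
  iter k sigma (fun _ => true) (j + m * 2 ^ k) = iter k sigma (fun _ => true) j.
Proof.
elim: m j => [|m IH] j; first by rewrite addn0.
by rewrite mulSn addnA IH iter_sigma_periodic.
Qed.

(** The length of W_i together with the separator that follows it, hence the distance between the
    two copies of W_i in W_(i+1). *)
Definition level (W0 : seq bool) i := ((size W0).+1 * 2 ^ i)%N.

Lemma levelS W0 i : level W0 i.+1 = (level W0 i + level W0 i)%N.
Proof. by rewrite /level expnS; lia. Qed.

Lemma level_gt0 W0 i : (0 < level W0 i)%N.
Proof. by rewrite muln_gt0 expn_gt0. Qed.

Lemma size_pword_level W0 eps i : (size (pword W0 eps i)).+1 = level W0 i.
Proof.
elim: i => [|i IH]; first by rewrite /level muln1.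
by rewrite levelS -IH /= size_cat addSn.
Qed.

Lemma pseq_nth W0 eps i j : (j < size (pword W0 eps i))%N ->
  pseq W0 eps j = nth false (pword W0 eps i) j.
Proof. by move=> h; rewrite -pseq_prefix nth_mkseq. Qed.

Lemma pseq_separator W0 eps i : pseq W0 eps (size (pword W0 eps i)) = eps i.
Proof.
rewrite (@pseq_nth _ _ i.+1) /= ?size_cat /= ?addnS ?ltnS ?leq_addr //.
by rewrite nth_cat ltnn subnn.
Qed.

Lemma pseq_shift W0 eps i j : (j < size (pword W0 eps i))%N ->
  pseq W0 eps (j + level W0 i) = pseq W0 eps j.
Proof.
move=> h; rewrite -(size_pword_level _ eps) (@pseq_nth _ _ i.+1) /=; last first.
  by rewrite size_cat /= ltn_add2r; lia.
rewrite nth_cat ltnNge (leq_trans (leqnSn _) (leq_addl _ _)) /=.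
by rewrite addnS -addSn addnK /= -pseq_nth.
Qed.

(** Only letters before position [j] are summed, and for [j < level W0 i] these lie inside W_i. *)
Lemma sigma_pseq_shift W0 eps i j : (j < level W0 i)%N ->
  sigma (pseq W0 eps) (j + level W0 i) =
  sigma (pseq W0 eps) (level W0 i) (+) sigma (pseq W0 eps) j.
Proof.
elim: j => [|j IH] jL; first by rewrite /sigma [X in _ (+) odd X]big_ord0 addbF.
rewrite addSn !sigmaS IH ?pseq_shift ?addbA //; last exact: ltnW.
by rewrite -ltnS size_pword_level.
Qed.

(** In the prefix W_i eps_i W_i eps_(i+1) the two copies of W_i cancel modulo 2. *)
Lemma sigma_pseq_level W0 eps i :
  sigma (pseq W0 eps) (level W0 i.+1) = eps i (+) eps i.+1.
Proof.
rewrite -(size_pword_level _ eps) sigmaS pseq_separator; congr (_ (+) _).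
rewrite /= size_cat /= size_pword_level sigma_pseq_shift; last first.
  by rewrite -(size_pword_level _ eps).
rewrite -{1}(size_pword_level _ eps) sigmaS pseq_separator.
by rewrite addbAC addbb.
Qed.

(** Induction on [k] by [sigma_shift]; the condition [k < i] makes the constant of summation
    vanish. *)
Lemma iter_sigma_pseq_shift W0 eps k i j : (k < i)%N -> (j < level W0 i)%N ->
  iter k.+1 sigma (pseq W0 eps) (j + level W0 i) =
  iter k.+1 sigma (pseq W0 eps) j (+)
    (sigma (pseq W0 eps) (level W0 i) && iter k sigma (fun _ => true) j).
Proof.
elim: k i j => [|k IH] i j ki jL.
  by rewrite /= sigma_pseq_shift // andbT addbC.
set x := iter k.+1 sigma _ in IH; rewrite !iterS -/x.
set b := sigma _ (level _ _).
have h l : (k < l)%N -> forall m, (m <= level W0 l)%N ->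
    sigma x (m + level W0 l) = sigma x (level W0 l) (+) (sigma x m (+)
      (sigma (pseq W0 eps) (level W0 l) && iter k.+1 sigma (fun _ => true) m)).
  by move=> kl; apply: sigma_shift => m; exact: IH.
rewrite h ?(ltnW ki) ?(ltnW jL) //.
suff -> : sigma x (level W0 i) = false by rewrite addFb.
(* With [i] lowered by one, the prefix consists of two halves of length [level W0 i]. Their sums
   cancel up to the summed twist. *)
case: i ki {jL b} => // i ki; rewrite levelS h // addbA addbb addFb.
suff -> : iter k.+1 sigma (fun _ => true) (level W0 i) = false by rewrite andbF.
(* The level is a multiple of the period [2 ^ k.+1], and the sequence starts with an empty sum. *)
rewrite /level -(subnK (ki : (k.+1 <= i)%N)) expnD mulnA -[(_ * _)%N]add0n.
rewrite iter_sigma_periodic_mul.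
by rewrite /= /sigma big_ord0.
Qed.

Local Open Scope ring_scope.

(** * Pairs of two-by-two matrices of determinant 1 in characteristic 2 *)

Lemma ord2P (i : 'I_2) : i = 0 \/ i = 1.
Proof. by case: i => [[|[|//]] h]; [left | right]; apply/val_inj. Qed.

Lemma mx2P (K : Type) (A B : 'M[K]_2) :
  A 0 0 = B 0 0 -> A 0 1 = B 0 1 -> A 1 0 = B 1 0 -> A 1 1 = B 1 1 -> A = B.
Proof.
move=> h00 h01 h10 h11; apply/matrixP => i j.
by case: (ord2P i) => ->; case: (ord2P j) => ->.
Qed.

Lemma mul2E (K : pzSemiRingType) m (A : 'M[K]_(m, 2)) (B : 'M[K]_2) i j :
  (A *m B) i j = A i 0 * B 0 j + A i 1 * B 1 j.
Proof.
rewrite mxE big_ord_recl big_ord1; congr (_ + A i _ * B _ j); exact/val_inj.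
Qed.

Lemma trace2E (K : pzSemiRingType) (A : 'M[K]_2) : \tr A = A 0 0 + A 1 1.
Proof. by rewrite /mxtrace big_ord_recl big_ord1; congr (_ + A _ _); apply/val_inj. Qed.

Lemma det2E (K : comNzRingType) (A : 'M[K]_2) :
  \det A = A 0 0 * A 1 1 - A 0 1 * A 1 0.
Proof.
rewrite (expand_det_row _ 0) big_ord_recl big_ord1 /cofactor !det_mx11 !mxE /=.
rewrite /bump /= expr0 expr1 mul1r mulN1r mulrN.
by congr (A _ _ * A _ _ - A _ _ * A _ _); apply/val_inj.
Qed.

Lemma mulr2E (K : nzSemiRingType) (A B : 'M[K]_2) i j :
  (A * B) i j = A i 0 * B 0 j + A i 1 * B 1 j.
Proof. exact: mul2E. Qed.

Lemma Cayley_Hamilton2 (K : comNzRingType) (A : 'M[K]_2) :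
  A * A = \tr A *: A - (\det A)%:M.
Proof.
by apply: mx2P; rewrite mulr2E trace2E det2E !mxE /= ?mulr0n ?mulr1n; ring.
Qed.

Lemma polarized_Cayley_Hamilton2 (K : comNzRingType) (A B : 'M[K]_2) :
  A * B + B * A = \tr A *: B + \tr B *: A + (\tr (A * B) - \tr A * \tr B)%:M.
Proof.
by apply: mx2P; rewrite [LHS]mxE !trace2E !mulr2E !mxE /= ?mulr0n ?mulr1n; ring.
Qed.

Lemma mx_addxx (K : comNzRingType) m n (A : 'M[K]_(m, n)) :
  2 \in [pchar K] -> A + A = 0.
Proof. by move=> K2; apply/matrixP => i j; rewrite !mxE addrr_pchar2. Qed.

Lemma det1_sqr (K : comNzRingType) (A : 'M[K]_2) :
  2 \in [pchar K] -> \det A = 1 -> A * A = \tr A *: A + 1.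
Proof.
move=> K2 dA; rewrite Cayley_Hamilton2 dA; congr (_ + _).
by apply/eqP; rewrite eq_sym -subr_eq0 opprK mx_addxx.
Qed.

Lemma trace_mx1 (K : comNzRingType) : 2 \in [pchar K] -> \tr (1 : 'M[K]_2) = 0.
Proof. by move=> K2; rewrite mxtrace1 -mulr_natr mul1r pcharf0. Qed.

Lemma trace_sqr (K : comNzRingType) (A : 'M[K]_2) :
  2 \in [pchar K] -> \det A = 1 -> \tr (A * A) = \tr A ^+ 2.
Proof.
by move=> K2 dA; rewrite det1_sqr // mxtraceD mxtraceZ trace_mx1 // addr0 expr2.
Qed.

Lemma anticommutator_det1 (K : comNzRingType) (A B : 'M[K]_2) :
    2 \in [pchar K] -> \tr A = \tr B ->
  A * B + B * A = \tr A *: (A + B) + (\tr (A * B) + \tr A ^+ 2)%:M.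
Proof.
move=> K2 tAB; rewrite polarized_Cayley_Hamilton2 -tAB -scalerDr [B + A]addrC.
by rewrite -expr2 (oppr_pchar2 K2).
Qed.

(** The parts proportional to [A + B] in A^2 + B^2 and in AB + BA cancel in characteristic 2. *)
Lemma sum_det1_sqr (K : comNzRingType) (A B : 'M[K]_2) :
    2 \in [pchar K] -> \det A = 1 -> \det B = 1 -> \tr A = \tr B ->
  (A + B) * (A + B) = (\tr (A * B) + \tr A ^+ 2)%:M.
Proof.
move=> K2 dA dB tAB; rewrite mulrDl !mulrDr (AC (2*2) ((1*4)*(2*3))) /=.
rewrite anticommutator_det1 // !det1_sqr // -tAB [_ + 1 + _]addrACA.
by rewrite [1 + 1]mx_addxx // addr0 -scalerDr addrA mx_addxx // add0r.
Qed.

(** Two computations of (A + B)^2 are compared. *)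
Lemma trace_mul_root (K : comNzRingType) (A B E : 'M[K]_2) (r : K) :
    2 \in [pchar K] -> \det A = 1 -> \det B = 1 -> \tr A = \tr B ->
    E * E = r%:M -> A + B = \tr A *: (E + 1) ->
  \tr (A * B) = \tr A ^+ 2 * r.
Proof.
move=> K2 dA dB tAB EE AB.
have e1 := sum_det1_sqr K2 dA dB tAB.
have e2 : (A + B) * (A + B) = (\tr A ^+ 2 * r + \tr A ^+ 2)%:M.
  rewrite AB -scalerAl -scalerAr scalerA -expr2 mulrDl !mulrDr EE !mulr1 mul1r.
  rewrite (AC (2*2) ((1*4)*(2*3))) /= mx_addxx // addr0 scalerDr scale_scalar_mx.
  by rewrite scalemx1 [RHS]raddfD.
have /matrixP/(_ 0 0) := etrans (esym e1) e2.
by rewrite !mxE !mulr1n => /addIr.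
Qed.

(** A doubling step with delta = 0 keeps E. *)
Lemma square_step (K : comNzRingType) (A B E : 'M[K]_2) :
    2 \in [pchar K] -> \det A = 1 -> \det B = 1 -> \tr A = \tr B ->
    A + B = \tr A *: (E + 1) ->
  A * A + B * B = \tr (A * A) *: (E + 1).
Proof.
move=> K2 dA dB tAB AB; rewrite trace_sqr // !det1_sqr // -tAB.
by rewrite [LHS]addrACA mx_addxx // addr0 -scalerDr AB scalerA expr2.
Qed.

(** A doubling step with delta = 1 replaces E by its inverse [r^-1 *: E]. *)
Lemma product_step (K : comUnitRingType) (A B E : 'M[K]_2) (r : K) :
    2 \in [pchar K] -> \det A = 1 -> \det B = 1 -> \tr A = \tr B ->
    r \is a GRing.unit -> E * E = r%:M -> A + B = \tr A *: (E + 1) ->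
  A * B + B * A = \tr (A * B) *: (r^-1 *: E + 1).
Proof.
move=> K2 dA dB tAB ur EE AB; have tE := trace_mul_root K2 dA dB tAB EE AB.
rewrite anticommutator_det1 // tE AB scalerA -expr2 !scalerDr scalerA mulrK //.
rewrite [in LHS]raddfD /= -[(_ * _)%:M]scalemx1 -[(_ ^+ 2)%:M]scalemx1.
rewrite (AC (2*2) (1*3*(2*4))) /=.
by rewrite mx_addxx // addr0.
Qed.

(** Together with [det1_sqr], this makes each doubling step affine: A is multiplied by a factor and
    1 is added. Unrolling this recursion produces the sum in [doubling_sum]. *)
Lemma mul_det1_root (K : comNzRingType) (A B E : 'M[K]_2) :
    2 \in [pchar K] -> \det A = 1 -> A + B = \tr A *: (E + 1) ->
  A * B = A * (\tr A *: E) + 1.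
Proof.
move=> K2 dA AB; have -> : B = A + \tr A *: (E + 1).
  by rewrite -AB addrA mx_addxx // add0r.
rewrite mulrDr det1_sqr // scalerDr mulrDr -[A * (_ *: 1)]scalerAr mulr1.
by rewrite (AC (2*2) ((1*4)*(3*2))) /= mx_addxx // add0r.
Qed.

(* The E, r and y_i of the introduction. *)
Definition sqrt_mx (K : comUnitRingType) (A B : 'M[K]_2) : 'M[K]_2 :=
  (\tr A)^-1 *: (A + B) + 1.

Definition trace_ratio (K : comUnitRingType) (A B : 'M[K]_2) : K :=
  \tr (A * B) / \tr A ^+ 2.

Fixpoint weight (K : comUnitRingType) (t r : K) (d : nat -> bool) (i : nat) : K :=
  if i is j.+1 then weight t r d j ^+ 2 / (t * (if sigma d j then r else 1))
  else 1.

Lemma sqrt_mx_sqr (K : comUnitRingType) (A B : 'M[K]_2) :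
    2 \in [pchar K] -> \det A = 1 -> \det B = 1 -> \tr A = \tr B ->
    \tr A \is a GRing.unit ->
  sqrt_mx A B * sqrt_mx A B = (trace_ratio A B)%:M.
Proof.
move=> K2 dA dB tAB uA; rewrite mulrDl !mulrDr !mulr1 !mul1r.
rewrite (AC (2*2) ((2*3)*(1*4))) /= mx_addxx // add0r.
rewrite -scalerAl -scalerAr scalerA sum_det1_sqr // scale_scalar_mx mulrDr.
rewrite -expr2 exprVn mulVr ?unitrX // [_%:M]raddfD /= -addrA.
by rewrite [_ + 1]mx_addxx // addr0 mulrC.
Qed.

Lemma sum_sqrt_mx (K : comUnitRingType) (A B : 'M[K]_2) :
    2 \in [pchar K] -> \tr A \is a GRing.unit ->
  A + B = \tr A *: (sqrt_mx A B + 1).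
Proof.
move=> K2 uA; rewrite /sqrt_mx -addrA mx_addxx // addr0 scalerA mulrV //.
by rewrite scale1r.
Qed.

Lemma weight_unit (K : comUnitRingType) (t r : K) d i :
  t \is a GRing.unit -> r \is a GRing.unit -> weight t r d i \is a GRing.unit.
Proof.
move=> ut ur; elim: i => [|i IH] /=; first exact: unitr1.
by rewrite unitrM unitrX // unitrV unitrM ut; case: sigma; rewrite ?unitr1.
Qed.

(** Here [r^-1 *: E] stands for E^-1. The induction carries three further invariants: equal traces,
    the value of [\tr (A i) * y i], and the expression of [A i + B i] through E or E^-1. *)
Lemma doubling_sum (K : comUnitRingType) (A B : nat -> 'M[K]_2) (d : nat -> bool) :
    2 \in [pchar K] ->
    (forall i, \det (A i) = 1) -> (forall i, \det (B i) = 1) ->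
    (forall i, A i.+1 = A i * (if d i then B i else A i)) ->
    (forall i, B i.+1 = B i * (if d i then A i else B i)) ->
    \tr (A 0%N) = \tr (B 0%N) ->
    let t := \tr (A 0%N) in let r := trace_ratio (A 0%N) (B 0%N) in
    let E := sqrt_mx (A 0%N) (B 0%N) in let y := weight t r d in
    t \is a GRing.unit -> r \is a GRing.unit -> forall i,
  A i = (A 0%N + 1 + \sum_(j < i.+1) y j *: (if sigma d j then r^-1 *: E else 1))
        * ((y i)^-1 *: (if sigma d i then E else 1)).
Proof.
move=> K2 dA dB SA SB tAB t r E y ut ur.
have EE : E * E = r%:M by exact: sqrt_mx_sqr.
have uy i : y i \is a GRing.unit by exact: weight_unit.
have sigma0 : sigma d 0 = false by rewrite /sigma big_ord0.
suff inv i : [/\ \tr (A i) = \tr (B i),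
    \tr (A i) * y i = t * (if sigma d i then r else 1),
    A i + B i = \tr (A i) *: ((if sigma d i then r^-1 *: E else E) + 1) &
    A i = (A 0%N + 1 +
      \sum_(j < i.+1) y j *: (if sigma d j then r^-1 *: E else 1))
        * ((y i)^-1 *: (if sigma d i then E else 1))].
  by move=> i; have [] := inv i.
elim: i => [|i [t_eq ty AB IH]].
  split=> //; rewrite ?sigma0 ?mulr1 //; first exact: sum_sqrt_mx.
  by rewrite big_ord1 sigma0 /y /= invr1 scale1r !mulr1 -addrA mx_addxx // addr0.
(* [F] is E or E^-1 according to s_i, and [q] is its square. *)
set F := (if sigma d i then r^-1 *: E else E) in AB.
pose q := if sigma d i then r^-1 else r.
have uq : q \is a GRing.unit by rewrite /q; case: sigma; rewrite ?unitrV.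
have FF : F * F = q%:M.
  rewrite /F /q; case: sigma => //; rewrite -scalerAl -scalerAr EE scalerA.
  by rewrite scale_scalar_mx mulrVK.
have trA : \tr (A i.+1) = \tr (A i) ^+ 2 * (if d i then q else 1).
  rewrite SA; case: (d i); last by rewrite trace_sqr // mulr1.
  exact: trace_mul_root FF AB.
have trB : \tr (B i.+1) = \tr (A i.+1).
  rewrite SA SB; case: (d i); first exact: mxtrace_mulC.
  by rewrite !trace_sqr // t_eq.
have ySE : y i.+1 = y i ^+ 2 / (t * (if sigma d i then r else 1)) by [].
have utA : \tr (A i) \is a GRing.unit.
  have : \tr (A i) * y i \is a GRing.unit.
    by rewrite ty unitrM ut; case: sigma; rewrite ?unitr1.
  by rewrite unitrM => /andP[].
have yS : y i.+1 = y i / \tr (A i).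
  by rewrite ySE -ty expr2 invrM // mulrACA mulrV // mul1r.
have qr : q * (if sigma d i then r else 1) = (if sigma d i then 1 else r).
  by rewrite /q; case: sigma; rewrite ?mulVr ?mulr1.
split=> //.
- rewrite trA yS [y i / _]mulrC mulrACA expr2 mulrK // [X in _ * X]mulrC mulrA.
  rewrite ty -mulrA sigmaS /q.
  by case: (d i); case: (sigma d i); rewrite /= ?mul1r ?mulrV ?mulVr ?mulr1.
- rewrite sigmaS.
  have -> : A i.+1 + B i.+1 =
      (if d i then A i * B i + B i * A i else A i * A i + B i * B i).
    by rewrite SA SB; case: (d i).
  rewrite SA /F /q in AB FF uq *; case: (d i) => /=.
    rewrite (product_step K2 _ _ t_eq uq FF AB) //; congr (_ *: (_ + _)).
    by case: sigma; rewrite //= ?invrK ?scalerA ?mulrV ?scale1r.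
  rewrite addbF; exact: square_step AB.
- rewrite big_ord_recr /= addrA.
  have gE : (if sigma d i then E else 1) * (if d i then F else 1)
          = (if sigma d i.+1 then E else 1).
    rewrite sigmaS /F; case: (d i); case: (sigma d i) => //=; rewrite ?mulr1 ?mul1r //.
    by rewrite -scalerAr EE scale_scalar_mx mulVr.
  have invE : (y i.+1)^-1 = \tr (A i) / y i by rewrite yS invrM ?unitrV // invrK.
  (* The factor turns y_i^-1 E^(s_i) into its successor, and the added 1 is the new summand times
     that successor. *)
  have step : A i.+1 = A i * (\tr (A i) *: (if d i then F else 1)) + 1.
    rewrite SA; case: (d i); first exact: mul_det1_root AB.
    by rewrite det1_sqr // -scalerAr mulr1.
  rewrite [LHS]step [X in X * _ + 1]IH [RHS]mulrDl; congr (_ + _).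
    rewrite -mulrA; congr (_ * _).
    by rewrite -scalerAl -scalerAr scalerA gE invE mulrC.
  rewrite -scalerAl -scalerAr scalerA mulrV // scale1r.
  case: (sigma d i.+1); last by rewrite mulr1.
  by rewrite -scalerAl EE scale_scalar_mx mulVr.
Qed.

(** * Algebraicity of quotients of polynomials in an algebraic series *)

Definition embed_eval (p : {poly {mpoly 'F_2[2]}}) (Y : laurent) : laurent :=
  (map_poly embed p).[Y].

Lemma embed_evalD p q Y : embed_eval (p + q) Y = embed_eval p Y + embed_eval q Y.
Proof. by rewrite /embed_eval rmorphD hornerD. Qed.

Lemma embed_evalM p q Y : embed_eval (p * q) Y = embed_eval p Y * embed_eval q Y.
Proof. by rewrite /embed_eval rmorphM hornerM. Qed.

Lemma embed_evalX p k Y : embed_eval (p ^+ k) Y = embed_eval p Y ^+ k.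
Proof. by rewrite /embed_eval rmorphXn horner_exp. Qed.

Lemma embed_evalZ c p Y : embed_eval (c *: p) Y = embed c * embed_eval p Y.
Proof. by rewrite /embed_eval map_polyZ hornerZ. Qed.

Lemma embed_evalC c Y : embed_eval c%:P Y = embed c.
Proof. by rewrite /embed_eval map_polyC hornerC. Qed.

Lemma embed_eval_coef D (p : {poly {mpoly 'F_2[2]}}) Y : (size p <= D)%N ->
  embed_eval p Y = \sum_(j < D) embed p`_j * Y ^+ j.
Proof.
move=> pD; rewrite /embed_eval (@horner_coef_wide _ D).
  by apply: eq_bigr => j _; rewrite coef_map.
by apply: leq_trans pD; rewrite size_poly.
Qed.

(** Modulo M, the D + 1 products P^i Q^(D - i) live in a space of dimension D, so they are
    dependent. Dividing the dependence by Q(Y)^D gives an equation for z. *)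
Lemma algebraic_quotient (M P Q : {poly {mpoly 'F_2[2]}}) (D : nat) (Y z : laurent) :
    size M = D.+1 -> embed_eval M Y = 0 ->
    embed (lead_coef M) \is a GRing.unit -> embed_eval Q Y \is a GRing.unit ->
    z * embed_eval Q Y = embed_eval P Y ->
  algebraic_of_degree_le D z.
Proof.
move=> sM MY uM uQ zQ.
have M0 : M != 0 by rewrite -size_poly_eq0 sM.
pose T (i : 'I_D.+1) := P ^+ i * Q ^+ (D - i).
(* The last column of [C] is zero because remainders have degree below D; it makes [C] square, so
   that a vanishing determinant yields the dependence [v] over F_2[A]. *)
pose C : 'M_D.+1 := \matrix_(i, j) (T i %% M)%R`_j.
have sT i : (size (T i %% M)%R <= D)%N by rewrite -ltnS -sM ltn_modp.
have detC : \det C = 0.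
  rewrite (expand_det_col _ ord_max) big1 // => i _.
  by rewrite !mxE nth_default ?mul0r.
have /det0P[v v0 vC] : \det C == 0 by rewrite detC.
(* Pseudo-division multiplies [T i] by a power of the leading coefficient, which must enter the
   coefficients of [p]. *)
pose k (i : 'I_D.+1) := scalp (T i) M.
pose p : {poly {mpoly 'F_2[2]}} :=
  \poly_(i < D.+1) (v 0 (inord i) * lead_coef M ^+ k (inord i)).
exists p; split; last 2 first.
- exact: size_poly.
- have uQD : embed_eval Q Y ^+ D \is a GRing.unit by rewrite unitrX.
  apply/eqP/(mulIr uQD); rewrite mul0r -/(embed_eval p z).
  rewrite (embed_eval_coef _ (size_poly _ _)) mulr_suml.
  rewrite (eq_bigr (fun i =>
    \sum_(j < D) embed (v 0 i * C i (widen_ord (leqnSn D) j)) * Y ^+ j)).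
    rewrite exchange_big big1 //= => j _; rewrite -mulr_suml -rmorph_sum.
    have /rowP/(_ (widen_ord (leqnSn D) j)) := vC.
    by rewrite !mxE => ->; rewrite rmorph0 mul0r.
  move=> i _; rewrite coef_poly ltn_ord inord_val rmorphM -!mulrA.
  rewrite (eq_bigr (fun j : 'I_D =>
    embed (v 0 i) * (embed (T i %% M)`_j * Y ^+ j))); last first.
    by move=> j _; rewrite rmorphM -mulrA mxE.
  rewrite -mulr_sumr -embed_eval_coef //; congr (_ * _).
  have : embed_eval (lead_coef M ^+ k i *: T i) Y = embed_eval (T i %% M) Y.
    by rewrite (Pdiv.Idomain.divp_eq) embed_evalD embed_evalM MY mulr0 add0r.
  move=> <-; rewrite embed_evalZ embed_evalM !embed_evalX -zQ exprMn -!mulrA.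
  by rewrite -exprD subnKC // -ltnS.
- have [i vi] : exists i, v 0 i != 0.
    apply/existsP; apply: contraNT v0; rewrite negb_exists => /forallP h.
    by apply/eqP/rowP => i; rewrite mxE; apply/eqP; rewrite -[_ == _]negbK h.
  apply: contraNneq vi => p0; have : p`_i = 0 by rewrite p0 coef0.
  rewrite coef_poly ltn_ord inord_val => /eqP; rewrite mulf_eq0 expf_eq0.
  by rewrite lead_coef_eq0 (negPf M0) andbF orbF.
Qed.

(* Denominators are required to be units: F_2((A)) contains no inverse of, say,
   a_0 + a_1. *)
Definition rational (x : laurent) : Prop :=
  exists p q, embed q \is a GRing.unit /\ embed q * x = embed p.

Lemma rational_embed p : rational (embed p).
Proof. by exists p, 1; rewrite rmorph1 unitr1 mul1r. Qed.

Lemma rational1 : rational 1.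
Proof. by rewrite -(rmorph1 embed); exact: rational_embed. Qed.

Lemma rational_letter b : rational (letter b).
Proof.
suff -> : letter b = embed 'X_(if b then 1 else 0) by exact: rational_embed.
by rewrite /embed mmapX mmap1U; case: b.
Qed.

Lemma rationalD x y : rational x -> rational y -> rational (x + y).
Proof.
move=> [p [q [uq e]]] [p' [q' [uq' e']]]; exists (q' * p + q * p'), (q * q').
rewrite !rmorphD !rmorphM /= -e -e' unitrM uq uq'; split=> //; ring.
Qed.

Lemma rationalM x y : rational x -> rational y -> rational (x * y).
Proof.
move=> [p [q [uq e]]] [p' [q' [uq' e']]]; exists (p * p'), (q * q').
by rewrite !rmorphM /= -e -e' unitrM uq uq' mulrACA.
Qed.

Lemma rationalV x : rational x -> rational x^-1.
Proof.
move=> [p [q [uq e]]]; case ux: (x \is a GRing.unit); last first.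
  by rewrite invr_out ?ux //; exists p, q.
by exists q, p; rewrite -e unitrM uq ux mulrK.
Qed.

Lemma rationalX x k : rational x -> rational (x ^+ k).
Proof.
move=> rx; elim: k => [|k IH]; first exact: rational1.
by rewrite exprS; apply: rationalM.
Qed.

Definition rational_poly_in (Y x : laurent) : Prop :=
  exists p q, embed q \is a GRing.unit /\ embed q * x = embed_eval p Y.

Lemma rational_poly_inC Y x : rational x -> rational_poly_in Y x.
Proof. by move=> [p [q [uq e]]]; exists p%:P, q; rewrite embed_evalC. Qed.

Lemma rational_poly_in_var Y : rational_poly_in Y Y.
Proof.
by exists 'X, 1; rewrite /embed_eval map_polyX hornerX rmorph1 unitr1 mul1r.
Qed.

Lemma rational_poly_inD Y x y :
  rational_poly_in Y x -> rational_poly_in Y y -> rational_poly_in Y (x + y).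
Proof.
move=> [p [q [uq e]]] [p' [q' [uq' e']]]; exists (q' *: p + q *: p'), (q * q').
rewrite embed_evalD !embed_evalZ rmorphM /= -e -e' unitrM uq uq'; split=> //; ring.
Qed.

Lemma rational_poly_inM Y x y :
  rational_poly_in Y x -> rational_poly_in Y y -> rational_poly_in Y (x * y).
Proof.
move=> [p [q [uq e]]] [p' [q' [uq' e']]]; exists (p * p'), (q * q').
by rewrite embed_evalM rmorphM /= -e -e' unitrM uq uq' mulrACA.
Qed.

Lemma rational_poly_inX Y x k :
  rational_poly_in Y x -> rational_poly_in Y (x ^+ k).
Proof.
move=> rx; elim: k => [|k IH]; first exact/rational_poly_inC/rational1.
by rewrite exprS; apply: rational_poly_inM.
Qed.

Lemma rational_poly_in_sum Y n (F : 'I_n -> laurent) :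
  (forall i, rational_poly_in Y (F i)) -> rational_poly_in Y (\sum_i F i).
Proof.
move=> h; apply: (big_ind (rational_poly_in Y)) => // [|x y].
  by exists 0, 1; rewrite mulr0 rmorph1 unitr1 /embed_eval rmorph0 horner0.
exact: rational_poly_inD.
Qed.

(** With kappa = a / b, the series Y is a root of a X^N + b - b X, of degree N as N > 1; z is then a
    quotient of polynomials in Y once denominators are cleared. *)
Lemma algebraic_of_equation (N : nat) (Y kappa u v z : laurent) :
    (1 < N)%N -> rational kappa -> kappa \is a GRing.unit ->
    Y = 1 + kappa * Y ^+ N ->
    rational_poly_in Y u -> rational_poly_in Y v -> v \is a GRing.unit ->
    z * v = u ->
  algebraic_of_degree_le N z.
Proof.
move=> N1 [a [b [ub e]]] uk EY [p [q [uq ep]]] [p' [q' [uq' ep']]] uv zv.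
have ua : embed a \is a GRing.unit by rewrite -e unitrM ub.
have a0 : a != 0 by apply: contraTneq ua => ->; rewrite rmorph0 unitr0.
pose M := a *: 'X^N + (b%:P - b *: 'X).
have sb : (size (b%:P - b *: 'X)%R <= 2)%N.
  rewrite (leq_trans (size_polyD _ _)) // geq_max size_polyN.
  rewrite (leq_trans (size_polyC_leq1 _)) //=.
  by rewrite (leq_trans (size_scale_leq _ _)) // size_polyX.
have sa : size (a *: 'X^N) = N.+1 by rewrite size_scale // size_polyXn.
have lt : (size (b%:P - b *: 'X)%R < size (a *: 'X^N))%N.
  by rewrite sa ltnS (leq_trans sb).
apply: (@algebraic_quotient M (q' *: p) (q *: p') N Y z).
- by rewrite size_polyDl.
- have -> : embed_eval M Y = embed a * Y ^+ N + (embed b - embed b * Y).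
    rewrite embed_evalD embed_evalZ /embed_eval map_polyXn hornerXn; congr (_ + _).
    by rewrite rmorphB /= map_polyC map_polyZ /= map_polyX hornerD hornerN !hornerE.
  by rewrite {2}EY -e; ring.
- by rewrite lead_coefDl // lead_coefZ lead_coefXn mulr1.
- by rewrite embed_evalZ -ep' !unitrM uq uq' uv.
- by rewrite !embed_evalZ -ep -ep' -zv; ring.
Qed.

(** * Continuant matrices *)

Lemma laurent_pchar2 : 2 \in [pchar laurent].
Proof. exact: (rmorph_pchar Defs.constant (pchar_Fp (isT : prime 2))). Qed.

Lemma laurent_addxx (x : laurent) : x + x = 0.
Proof. exact: addrr_pchar2 laurent_pchar2 x. Qed.

Lemma laurent_oppr (x : laurent) : - x = x.
Proof. exact: oppr_pchar2 laurent_pchar2 x. Qed.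

Lemma letter_unit b : letter b \is a GRing.unit.
Proof. by have [] := letterD_unit b (@small0 1); rewrite addr0. Qed.

Lemma letterV_small b : small 1 (letter b)^-1.
Proof. by have [] := letterD_unit b (@small0 1); rewrite addr0. Qed.

(** By the geometric series, since [v] inverts [x] up to a small relative error. As [laurent] is not
    a field, units are obtained in this way, with a bound on the inverse. *)
Lemma unit_of_small (v x : laurent) (e : nat) :
    small e v -> small 1 (v * x - 1) ->
  x \is a GRing.unit /\ exists2 c, small 0 c & x^-1 = v * c.
Proof.
move=> sv svx; have [] := @small_geometric (1 - v * x).
  by rewrite -opprB; apply: smallN.
move=> c sc; rewrite opprB addrC subrK mulrA => h.
have ux : x \is a GRing.unit by apply/unitrPr; exists (c * v); rewrite mulrC.
by split=> //; exists c => //; rewrite -[_^-1]mul1r -h mulrK // mulrC.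
Qed.

(** The matrix of the Moebius map y -> [letter b] + 1/y. *)
Definition letter_mx (b : bool) : 'M[laurent]_2 :=
  \matrix_(i, j) if (i == 0) && (j == 0) then letter b else (i != j)%:R.

Definition word_mx (w : seq bool) : 'M[laurent]_2 := \prod_(b <- w) letter_mx b.

(** The inverse of the leading monomial of [word_mx w 0 0], the yardstick for sizes below. *)
Definition word_inv (w : seq bool) : laurent := \prod_(b <- w) (letter b)^-1.

Lemma word_mx_cat w w' : word_mx (w ++ w') = word_mx w * word_mx w'.
Proof. exact: big_cat. Qed.

Lemma word_mx_cons b w :
  [/\ word_mx (b :: w) 0 0 = letter b * word_mx w 0 0 + word_mx w 1 0,
      word_mx (b :: w) 0 1 = letter b * word_mx w 0 1 + word_mx w 1 1,
      word_mx (b :: w) 1 0 = word_mx w 0 0 &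
      word_mx (b :: w) 1 1 = word_mx w 0 1].
Proof.
by split; rewrite /word_mx big_cons mulr2E !mxE //= ?mul0r ?mul1r ?addr0.
Qed.

Lemma det_word_mx w : \det (word_mx w) = 1.
Proof.
elim: w => [|b w IH]; first by rewrite /word_mx big_nil det1.
rewrite /word_mx big_cons det_mulmx -/(word_mx w) IH mulr1 det2E !mxE /=.
by rewrite mulr0 sub0r mulr1 laurent_oppr.
Qed.

Lemma rational_word_mx w i j : rational (word_mx w i j).
Proof.
have rb (b : bool) : rational (b%:R).
  case: b; first exact: rational1.
  by rewrite mulr0n -(rmorph0 embed); exact: rational_embed.
elim: w i j => [|b w IH] i j; first by rewrite /word_mx big_nil mxE; exact: rb.
rewrite /word_mx big_cons mulr2E; apply: rationalD; apply: rationalM => //;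
  rewrite mxE; case: ifP => // _; exact: rational_letter.
Qed.

Lemma word_inv_small w : small (size w) (word_inv w).
Proof.
elim: w => [|b w IH]; first by rewrite /word_inv big_nil; exact: small1.
by rewrite /word_inv big_cons; apply: (@smallM 1) => //; exact: letterV_small.
Qed.

Lemma word_inv_cat w w' : word_inv (w ++ w') = word_inv w * word_inv w'.
Proof. exact: big_cat. Qed.

(** The upper left entry is the continuant of the whole word; the others omit the last letter, the
    first or both. The lower right bound is weak because that entry is 1 for the empty word. *)
Lemma word_mx_lead w :
  [/\ small 1 (word_inv w * word_mx w 0 0 - 1), small 1 (word_inv w * word_mx w 0 1),
      small 1 (word_inv w * word_mx w 1 0) & small 0 (word_inv w * word_mx w 1 1)].
Proof.
elim: w => [|b w [h00 h01 h10 h11]].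
  rewrite /word_inv /word_mx !big_nil !mxE /= mulr1 mulr0 subrr.
  by split; try exact: small0; exact: small1.
have [-> -> -> ->] := word_mx_cons b w.
have sb := @letterV_small b; have ub := letter_unit b.
rewrite /word_inv big_cons -/(word_inv w) !mulrDr.
have c x : (letter b)^-1 * word_inv w * (letter b * x) = word_inv w * x.
  by rewrite mulrACA mulVr // mul1r.
rewrite !c -[word_inv w * _ + _ - 1]addrAC -!mulrA.
have h00' : small 0 (word_inv w * word_mx w 0 0).
  rewrite -[X in small _ X](subrK 1); apply: smallD small1.
  exact: small_leq h00 _.
split.
- by apply: smallD => //; apply: small_leq (smallM sb h10) _.
- by apply: smallD => //; apply: smallM sb h11.
- exact: smallM sb h00'.
- exact: small_leq (smallM sb h01) _.
Qed.

Lemma word_mx_entry_small w i j : small 0 (word_inv w * word_mx w i j).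
Proof.
have [h00 h01 h10 h11] := word_mx_lead w.
case: (ord2P i) => ->; case: (ord2P j) => -> //.
- rewrite -[X in small _ X](subrK 1); apply: smallD small1.
  exact: small_leq h00 _.
- exact: small_leq h01 _.
- exact: small_leq h10 _.
Qed.

(** The lower right entry is negligible against the upper left one. The empty word is different: its
    trace is 1 + 1 = 0. *)
Lemma word_mx_trace_lead w : w != [::] ->
  small 1 (word_inv w * \tr (word_mx w) - 1).
Proof.
case: w => // b w _; rewrite trace2E mulrDr addrAC; apply: smallD.
  by have [] := word_mx_lead (b :: w).
have [_ _ _ ->] := word_mx_cons b w; have [_ h01 _ _] := word_mx_lead w.
rewrite /word_inv big_cons -mulrA.
by apply: small_leq (smallM (@letterV_small b) h01) _.
Qed.

(** [CF] is given only as a limit; the recursion of [cfrac] passes to it by uniqueness of limits. *)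
Lemma CF_step x :
  [/\ CF x = letter (x 0%N) + (CF (fun i => x i.+1))^-1,
      CF x \is a GRing.unit & small 1 (CF x)^-1].
Proof.
have tail z : exists y, [/\ small 1 y, CF z = letter (z 0%N) + y &
    forall m, small m (y - (cfrac (fun i => z i.+1) m)^-1)].
  pose u m := (cfrac (fun i => z i.+1) m)^-1.
  have [y hy] : exists y, forall m, small m (y - u m).
    apply: small_complete => m; last exact: cfracV_small.
    by apply: small_leq (cfrac_unit_small _ _).2 _.
  exists y; split=> //.
    rewrite -[y](subrK (u 1%N)); apply: smallD; first exact: hy.
    exact: (cfrac_unit_small _ _).2.
  apply: converges_unique (CF_converges z) _; apply: small_converges => m /=.
  by rewrite opprD addrACA subrr add0r; apply: hy.
have unitCF z : CF z \is a GRing.unit /\ small 1 (CF z)^-1.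
  by have [y [sy -> _]] := tail z; exact: letterD_unit.
have [ux sx] := unitCF x; split=> //.
have [y [sy -> hy]] := tail x; congr (_ + _); apply/eqP; rewrite -subr_eq0.
set x' := fun i => x i.+1 in hy *; apply/eqP/small_eq0 => d.
have [ux' sx'] := unitCF x'; have [y' [_ Ex' hy']] := tail x'.
set u := cfrac x' d.+1; have uu : u \is a GRing.unit by exact: cfrac_unit.
(* Both inverses are compared with that of the convergent [u] of the tail. *)
have -> : y - (CF x')^-1 = (y - u^-1) + (u^-1 * (CF x')^-1) * (CF x' - u).
  rewrite mulrBr mulrVK // [u^-1 * _]mulrC mulrVK //.
  by rewrite addrA subrK.
apply: smallD; first exact: small_leq (hy d.+1) _.
rewrite -[d]add0n; apply: smallM.
  apply: (@small_leq _ (1 + 1)) => //; apply: smallM => //.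
  exact: (cfrac_unit_small _ _).2.
by rewrite Ex' /u /= opprD addrACA subrr add0r; exact: hy'.
Qed.

Lemma CF_unit x : CF x \is a GRing.unit. Proof. by have [] := CF_step x. Qed.

Lemma CFV_small x : small 1 (CF x)^-1. Proof. by have [] := CF_step x. Qed.

(** The Moebius action of the prefix on the tail, cleared of denominators. *)
Lemma CF_prefix x k : let M := word_mx (mkseq x k) in
  let z := CF (fun i => x (k + i)%N) in
  M 0 0 * z + M 0 1 = CF x * (M 1 0 * z + M 1 1).
Proof.
elim: k x => [|k IH] x /=.
  by rewrite /word_mx big_nil !mxE /= mul1r mul0r addr0 add0r mulr1.
have -> : mkseq x k.+1 = x 0%N :: mkseq (fun i => x i.+1) k.
  by rewrite /mkseq /= -[1%N]addn0 iotaDl -map_comp.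
have [-> -> -> ->] := word_mx_cons (x 0%N) (mkseq (fun i => x i.+1) k).
move: (IH (fun i => x i.+1)) => /=; set z := CF (fun i => x _).
set M := word_mx _ => h; have [-> _ _] := CF_step x.
rewrite h [RHS]mulrDl mulKr ?CF_unit // -h; ring.
Qed.

(** These are the approximation errors of convergents, signs being immaterial. Determinant 1 makes
    the first the inverse of [M 1 0 * z + M 1 1], and the second is [z] times the first. *)
Lemma CF_prefix_error x k : (0 < k)%N -> let M := word_mx (mkseq x k) in
  small 0 (M 0 0 + CF x * M 1 0) /\ small 0 (M 0 1 + CF x * M 1 1).
Proof.
case: k => // k _ M; have := CF_prefix x k.+1; rewrite -/M /=.
set z := CF (fun i => _) => h.
have uz : z \is a GRing.unit by exact: CF_unit.
have dM : M 0 0 * M 1 1 + M 0 1 * M 1 0 = 1.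
  by rewrite -[M 0 1 * _]laurent_oppr -det2E det_word_mx.
(* [g * z] is the Moebius denominator. For a nonempty prefix [g] is dominated by [M 1 0], the
   continuant without the first letter. *)
pose g := M 1 0 + M 1 1 * z^-1.
have [ug sg] : g \is a GRing.unit /\ small 0 g^-1.
  rewrite /g /M.
  have -> : mkseq x k.+1 = x 0%N :: mkseq (fun i => x i.+1) k.
    by rewrite /mkseq /= -[1%N]addn0 iotaDl -map_comp.
  set w := mkseq _ k; have [_ _ -> ->] := word_mx_cons (x 0%N) w.
  have [h00 h01 _ _] := word_mx_lead w; set v := word_inv w in h00 h01.
  have sv : small 0 v by apply: small_leq (@word_inv_small w) _.
  case: (@unit_of_small v (word_mx w 0 0 + word_mx w 0 1 * z^-1) 0 sv).
    rewrite mulrDr addrAC mulrA; apply: smallD => //.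
    by apply: small_leq (smallM h01 (@CFV_small _)) _.
  by move=> ug [c sc ->]; split=> //; exact: (smallM sv sc).
have gz : g * z = M 1 0 * z + M 1 1 by rewrite mulrDl mulrVK.
have e1 : (M 0 0 + CF x * M 1 0) * (g * z) = 1.
  by rewrite mulrDl [CF x * _]mulrC -[X in _ + X]mulrA gz -h -dM !mulrDr;
    rewrite -[RHS]addr0 -(laurent_addxx (M 0 0 * M 1 0 * z)); ring.
have fe : M 0 1 + CF x * M 1 1 = (M 0 0 + CF x * M 1 0) * z.
  apply/eqP; rewrite -[X in _ == X]laurent_oppr -addr_eq0; apply/eqP.
  rewrite -[RHS](laurent_addxx (CF x * (M 1 0 * z + M 1 1))) -{1}h; ring.
have f1 : (M 0 1 + CF x * M 1 1) = g^-1.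
  by rewrite fe -[LHS](mulrK ug) -[_ * z * g]mulrA [z * g]mulrC e1 mul1r.
split; last by rewrite f1.
rewrite -[X in small _ X](mulrK uz) -fe f1.
by apply: small_leq (smallM sg (@CFV_small _)) _.
Qed.

(** * The limit of the doubling process *)

Lemma rational_weight t r d i : rational t -> rational r -> rational (weight t r d i).
Proof.
move=> rt rr; elim: i => [|i IH] /=; first exact: rational1.
apply/rationalM/rationalV; first exact: rationalX.
by apply: rationalM => //; case: sigma => //; exact: rational1.
Qed.

Lemma rational_mx1 n (i j : 'I_n) : rational ((1%:M : 'M_n) i j).
Proof.
rewrite mxE; case: (i == j); first exact: rational1.
by rewrite mulr0n -(rmorph0 embed); exact: rational_embed.
Qed.

Lemma rational_trace (X : 'M[laurent]_2) :
  (forall i j, rational (X i j)) -> rational (\tr X).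
Proof. by move=> h; rewrite trace2E; apply: rationalD. Qed.

Lemma laurent_exprD2 (x y : laurent) k :
  (x + y) ^+ (2 ^ k) = x ^+ (2 ^ k) + y ^+ (2 ^ k).
Proof.
apply: exprDn_pchar; apply/pnatP => [|p pp]; first by rewrite expn_gt0.
by rewrite Euclid_dvdX // dvdn_prime2 // => /andP[/eqP -> _]; exact: laurent_pchar2.
Qed.

Lemma small_exp d (x : laurent) k : small d x -> (0 < k)%N -> small d (x ^+ k).
Proof.
move=> sx; case: k => // k _; elim: k => [|k IH]; first by rewrite expr1.
by rewrite exprS; apply: small_leq (smallM sx IH) _; exact: leq_addr.
Qed.

Lemma small0_exp (x : laurent) k : small 0 x -> small 0 (x ^+ k).
Proof.
by case: k => [|k] sx; [exact: small1 | exact: small_exp].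
Qed.

Lemma small_sum d n (F : 'I_n -> laurent) :
  (forall i, small d (F i)) -> small d (\sum_i F i).
Proof.
move=> h; apply: (big_ind (small d)) => [|x y|i _]; last exact: h.
  exact: small0.
exact: smallD.
Qed.

(** An even sum over a period lets the partial sums inherit the period [n] itself. *)
Lemma sigma_periodic d n : (forall i, d (i + n)%N = d i) -> sigma d n = false ->
  forall l j, sigma d (l * n + j) = sigma d j.
Proof.
move=> per dn; elim=> [|l IH] j; first by [].
rewrite mulSn -addnA -[RHS]IH; elim: (l * n + j)%N => [|i IHi].
  by rewrite addn0 dn /sigma big_ord0.
by rewrite addnS !sigmaS IHi addnC per.
Qed.

(** Each step of the recursion squares and then divides by a factor depending only on s_j, which is
    n-periodic. *)
Lemma weight_periodic (t r : laurent) d n :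
    (forall i, d (i + n)%N = d i) -> sigma d n = false -> forall l j,
  weight t r d (l * n + j) = weight t r d j * weight t r d (l * n) ^+ (2 ^ j).
Proof.
move=> per dn l; elim=> [|j IH]; first by rewrite addn0 expr1 mul1r.
rewrite addnS /= IH sigma_periodic // exprMn -exprM -expnSr.
by rewrite mulrAC.
Qed.

(** Indices are grouped by residue modulo [n]; additivity of Frobenius moves the power 2^j outside
    the inner sum. *)
Lemma weight_sum_periodic (V : lmodType laurent) (t r : laurent) d n (F : bool -> V) m :
    (forall i, d (i + n)%N = d i) -> sigma d n = false ->
  \sum_(j < m * n) weight t r d j *: F (sigma d j) =
  \sum_(j < n) (weight t r d j * (\sum_(l < m) weight t r d (l * n)) ^+ (2 ^ j))
     *: F (sigma d j).
Proof.
move=> per dn; elim: m => [|m IH].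
  rewrite mul0n !big_ord0 big1 // => j _.
  by rewrite expr0n expn_eq0 mulr0 scale0r.
rewrite mulSnr big_split_ord /= IH -big_split; apply: eq_bigr => j _ /=.
rewrite big_ord_recr /= weight_periodic // sigma_periodic //.
by rewrite laurent_exprD2 mulrDr scalerDl.
Qed.

(** The partial sums satisfy u_(m+1) = 1 + y_n u_m^(2^n), and the limit is taken. *)
Lemma weight_series_equation (t r Y : laurent) d n :
    (forall i, d (i + n)%N = d i) -> sigma d n = false ->
    (forall i, small i (weight t r d i)) ->
    (forall m, small m (Y - \sum_(l < m) weight t r d (l * n))) ->
  Y = 1 + weight t r d n * Y ^+ (2 ^ n).
Proof.
move=> per dn sw hY; set u := (fun m => \sum_(l < m) weight t r d (l * n)) in hY.
have uS m : u m.+1 = 1 + weight t r d n * u m ^+ (2 ^ n).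
  elim: m => [|m IH].
    by rewrite /u big_ord1 big_ord0 expr0n expn_eq0 mulr0 addr0.
  have uR k : u k.+1 = u k + weight t r d (k * n) by rewrite /u big_ord_recr.
  rewrite uR {1}IH -addrA uR laurent_exprD2 mulrDr; congr (_ + (_ + _)).
  by rewrite -weight_periodic // mulSnr.
apply/eqP; rewrite -subr_eq0; apply/eqP/small_eq0 => m.
have -> : Y - (1 + weight t r d n * Y ^+ (2 ^ n)) =
    (Y - u m.+1) - weight t r d n * (Y - u m) ^+ (2 ^ n).
  have -> : Y - u m = Y + u m by rewrite laurent_oppr.
  rewrite laurent_exprD2 uS -[LHS]subr0.
  rewrite -(laurent_addxx (weight t r d n * u m ^+ (2 ^ n))); ring.
apply: smallB; first exact: small_leq (hY m.+1) _.
rewrite -[m]add0n; apply: smallM; first exact: small_leq (sw n) _.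
by apply: small_exp; rewrite ?expn_gt0.
Qed.

Lemma word_trace_unit w : w != [::] ->
  \tr (word_mx w) \is a GRing.unit /\
  exists2 c, small 0 c & (\tr (word_mx w))^-1 = word_inv w * c.
Proof.
move=> w0; apply: unit_of_small (@word_inv_small w) _.
exact: word_mx_trace_lead.
Qed.

(** The trace is as large as the product of all letters of [w ++ w']: those of [w] absorb [x], and
    those of [w'] leave at least one degree. *)
Lemma mul_trace_inv_small (x : laurent) w w' : w != [::] -> w' != [::] ->
    small 0 (word_inv w * x) ->
  small 1 (x / \tr (word_mx (w ++ w'))).
Proof.
move=> w0 w0' sx; have ww0 : w ++ w' != [::].
  by rewrite -size_eq0 size_cat addn_eq0 size_eq0 (negPf w0).
have [_ [c sc ->]] := word_trace_unit ww0.
rewrite word_inv_cat mulrA mulrA [x * _]mulrC.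
have s1 : small 1 (word_inv w').
  by apply: small_leq (@word_inv_small w') _; rewrite lt0n size_eq0.
by apply: (@smallM 1 0) => //; apply: (@smallM 0 1).
Qed.

Lemma weight_bounds (t tau : laurent) (E : 'M[laurent]_2) d :
    t \is a GRing.unit -> tau \is a GRing.unit ->
    small 1 t^-1 -> small 2 tau^-1 -> small 1 (t / tau) ->
    (forall i j, small 1 (t / tau * E i j)) ->
    let r := tau / t ^+ 2 in
  (forall i, small i (weight t r d i)) /\
  (forall i j k, small i
     ((weight t r d i *: (if sigma d i then r^-1 *: E else 1)) j k)).
Proof.
move=> ut utau st stau sttau sE r.
have rV : r^-1 = t ^+ 2 / tau by rewrite /r invrM ?unitrV ?unitrX // invrK.
have ur : r \is a GRing.unit by rewrite unitrM unitrV unitrX ?utau.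
have sigma0 : sigma d 0 = false by rewrite /sigma big_ord0.
have trV : (t * r)^-1 = t / tau.
  by rewrite invrM // rV expr2 -!mulrA [tau^-1 / t]mulrC mulVKr.
have yS i : weight t r d i.+1 =
    weight t r d i ^+ 2 / (t * (if sigma d i then r else 1)) by [].
(* The second bound drives the induction: the next weight times [t] is either y^2 or (y t)^2 / tau,
   and the latter is not controlled by a bound on y alone. *)
have sw i : small i (weight t r d i) /\ small i (weight t r d i.+1 * t).
  elim: i => [|i [IH IHt]].
    rewrite /= sigma0 expr1n mulr1 mul1r mulVr //; split; exact: small1.
  have SE : weight t r d i.+2 =
      weight t r d i.+1 ^+ 2 * (if sigma d i.+1 then t / tau else t^-1).
    by rewrite yS; case: ifP; rewrite ?mulr1 ?trV.
  have sS : small i.+1 (weight t r d i.+1).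
    rewrite -[X in small _ X](mulrK ut).
    by apply: small_leq (smallM IHt st) _; rewrite addn1.
  split=> //; rewrite SE; case: ifP => _.
    have -> : weight t r d i.+1 ^+ 2 * (t / tau) * t =
      (weight t r d i.+1 * t) * (weight t r d i.+1 * t) / tau by ring.
    apply: small_leq (smallM (smallM IHt IHt) stau) _; lia.
  by rewrite mulrVK // expr2; apply: small_leq (smallM sS sS) _; exact: leq_addr.
split=> [i|[|i] j k]; first by have [] := sw i.
  rewrite sigma0 scale1r mxE => n; case: (j == k) => h; first exact: (small1 h).
  exact: (@small0 0 n h).
rewrite mxE; case: (sigma d i.+1); last first.
  rewrite mxE; case: (j == k); last by rewrite mulr0; exact: small0.
  by rewrite mulr1; have [] := sw i.+1.
have [_ swt] := sw i; rewrite mxE rV.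
have -> : weight t r d i.+1 * (t ^+ 2 / tau * E j k) =
   (weight t r d i.+1 * t) * (t / tau * E j k) by ring.
by apply: small_leq (smallM swt (@sE j k)) _; rewrite addn1.
Qed.

(** Here [xb] is the twist of [x] and [d] is delta. The row (1, CF x) stays bounded on every A_i
    while y_i E^(-s_i) tends to 0, so in the limit the row annihilates the first column of S. *)
Lemma algebraic_of_doubling (x xb : nat -> bool) (len : nat -> nat)
    (d : nat -> bool) (n : nat) :
    (0 < n)%N -> (forall i, 0 < len i)%N ->
    (forall i, mkseq x (len i.+1) =
       mkseq x (len i) ++ mkseq (if d i then xb else x) (len i)) ->
    (forall i, mkseq xb (len i.+1) =
       mkseq xb (len i) ++ mkseq (if d i then x else xb) (len i)) ->
    (forall i, d (i + n)%N = d i) -> sigma d n = false ->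
    \tr (word_mx (mkseq x (len 0%N))) = \tr (word_mx (mkseq xb (len 0%N))) ->
  algebraic_of_degree_le (2 ^ n) (CF x).
Proof.
move=> n0 len0 xS xbS per dn tAB.
pose A i := word_mx (mkseq x (len i)); pose B i := word_mx (mkseq xb (len i)).
have neq_nil z i : mkseq z (len i) != [::] :> seq bool.
  by rewrite -size_eq0 size_mkseq -lt0n.
set w := mkseq x (len 0%N) in tAB; set wb := mkseq xb (len 0%N) in tAB.
pose t := \tr (A 0%N); pose tau := \tr (A 0%N * B 0%N).
pose E := sqrt_mx (A 0%N) (B 0%N); pose r := trace_ratio (A 0%N) (B 0%N).
have [ut [c sc tV]] :
    t \is a GRing.unit /\ exists2 c, small 0 c & t^-1 = word_inv w * c.
  by apply: word_trace_unit; exact: neq_nil.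
have tauE : tau = \tr (word_mx (w ++ wb)) by rewrite word_mx_cat.
have [utau [c' sc' tauV]] : tau \is a GRing.unit /\
    exists2 c, small 0 c & tau^-1 = word_inv w * word_inv wb * c.
  rewrite tauE -word_inv_cat; apply: word_trace_unit.
  by rewrite -size_eq0 size_cat addn_eq0 size_eq0 (negPf (neq_nil _ _)).
have sA j k : small 1 (A 0%N j k / tau).
  rewrite tauE; apply: mul_trace_inv_small; rewrite ?neq_nil //.
  exact: word_mx_entry_small.
have sB j k : small 1 (B 0%N j k / tau).
  (* Cyclicity of the trace puts [wb] first, so that B is treated like A. *)
  rewrite tauE word_mx_cat [\tr _]mxtrace_mulC.
  have -> : word_mx wb *m word_mx w = word_mx (wb ++ w) by rewrite word_mx_cat.
  by apply: mul_trace_inv_small; rewrite ?neq_nil //; exact: word_mx_entry_small.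
have st_tau : small 1 (t / tau) by rewrite /t trace2E mulrDl; exact: smallD.
have sw1 z : small 1 (word_inv (mkseq z (len 0%N))).
  by apply: small_leq (@word_inv_small _) _; rewrite size_mkseq.
have st : small 1 t^-1 by rewrite tV; exact: smallM (sw1 x) sc.
have stau : small 2 tau^-1 by rewrite tauV; exact: smallM (smallM (sw1 x) (sw1 xb)) sc'.
have ur : r \is a GRing.unit by rewrite unitrM unitrV unitrX ?utau.
have sE j k : small 1 (t / tau * E j k).
  have -> : t / tau * E j k =
      A 0%N j k / tau + B 0%N j k / tau + (j == k)%:R * (t / tau).
    rewrite /E /sqrt_mx !mxE mulrDr mulrACA mulrV // mul1r.
    by rewrite [tau^-1 * _]mulrC mulrDl [t / tau * _]mulrC.
  apply: smallD; first exact: smallD.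
  by case: (j == k); rewrite ?mul1r // mul0r; exact: small0.
have [sy sth] := weight_bounds d ut utau st stau st_tau sE.
rewrite -/r in sy sth.
pose y := weight t r d; pose th b : 'M[laurent]_2 := if b then r^-1 *: E else 1.
have Asum i : A i = (A 0%N + 1 + \sum_(j < i.+1) y j *: th (sigma d j))
        * ((y i)^-1 *: (if sigma d i then E else 1)).
  apply: (doubling_sum laurent_pchar2) => //; try by move=> j; exact: det_word_mx.
    by move=> j; rewrite /A xS word_mx_cat /B; case: (d j).
  by move=> j; rewrite /B xbS word_mx_cat /A; case: (d j).
have EE : E * E = r%:M.
  by apply: (sqrt_mx_sqr laurent_pchar2) => //; exact: det_word_mx.
have uy i : y i \is a GRing.unit by exact: weight_unit.
pose u m := \sum_(l < m) y (l * n)%N.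
have [Y hY] : exists Y, forall m, small m (Y - u m).
  apply: small_complete => m.
    by apply: small_sum => l; apply: small_leq (@sy _) _.
  rewrite /u big_ord_recr /= addrAC subrr add0r.
  by apply: small_leq (@sy _) _; exact: leq_pmulr.
have EY : Y = 1 + y n * Y ^+ (2 ^ n) by exact: weight_series_equation.
have sY : small 0 Y by have := hY 0%N; rewrite /u big_ord0 subr0.
pose S (v : laurent) := A 0%N + 1 +
  \sum_(j < n) (y j * v ^+ (2 ^ j)) *: th (sigma d j).
(* At i = m n - 1 the closed form of A_i has exactly the m n summands regrouped in [S (u m)];
   multiplying by y_i E^(-s_i) removes its right factor. *)
have row_small m : (0 < m)%N ->
    small (m * n).-1 (S (u m) 0 0 + CF x * S (u m) 1 0).
  move=> m0; have mn0 : (0 < m * n)%N by rewrite muln_gt0 m0.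
  set i := (m * n).-1; have iE : i.+1 = (m * n)%N by exact: prednK.
  have -> : S (u m) = A i * (y i *: th (sigma d i)).
    rewrite /S -weight_sum_periodic // -iE [A i]Asum -mulrA -scalerAr -scalerAl.
    rewrite scalerA mulrV // scale1r /th; case: (sigma d i); last by rewrite !mulr1.
    by rewrite -scalerAr EE scale_scalar_mx mulVr // mulr1.
  set X := y i *: _; have sX j k : small i (X j k) by exact: sth.
  have [e0 e1] := @CF_prefix_error x (len i) (len0 i).
  rewrite !mulr2E mulrDr !mulrA addrACA -!mulrDl.
  by apply: smallD; rewrite -[i]add0n; exact: smallM.
(* [CF x] has a letter as leading term and so is not bounded by [small]; dividing by it restores the
   estimates. *)
have S_close m : small m ((CF x)^-1 * (S Y 0 0 + CF x * S Y 1 0)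
     - (CF x)^-1 * (S (u m) 0 0 + CF x * S (u m) 1 0)).
  have SB j k : small m (S Y j k - S (u m) j k).
    rewrite [X in small m X](_ : _ =
        \sum_(l < n) (y l *: th (sigma d l)) j k * (Y - u m) ^+ (2 ^ l)).
      apply: small_sum => l; rewrite -[m]add0n; apply: smallM.
        by apply: small_leq (@sth _ _ _) _.
      by apply: small_exp (hY m) _; rewrite expn_gt0.
    rewrite !mxE opprD addrACA subrr add0r !summxE -sumrB; apply: eq_bigr => l _.
    have -> : Y - u m = Y + u m by rewrite laurent_oppr.
    by rewrite laurent_exprD2 !mxE laurent_oppr; ring.
  rewrite -mulrBr opprD addrACA -mulrBr mulrDr mulKr ?CF_unit //.
  apply: smallD => //; apply: small_leq (smallM (@CFV_small x) (SB _ _)) _; lia.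
have row0 : S Y 0 0 + CF x * S Y 1 0 = 0.
  have uV : (CF x)^-1 \is a GRing.unit by rewrite unitrV CF_unit.
  apply: (mulrI uV); rewrite mulr0; apply: small_eq0 => m.
  rewrite -[X in small m X](subrK ((CF x)^-1 *
    (S (u m.+1) 0 0 + CF x * S (u m.+1) 1 0))).
  apply: smallD; first by apply: small_leq (S_close m.+1) _.
  apply: small_leq (smallM (@CFV_small x) (row_small m.+1 _)) _ => //.
  rewrite add1n prednK ?muln_gt0 //.
  by apply: leq_trans (leqnSn m) _; exact: leq_pmulr.
(* The entry is dominated by [A 0%N 1 0], the continuant of the prefix without its first letter.
   Summands of positive index are small, and that of index 0 is a multiple of the identity, hence
   zero off the diagonal. *)
have den_unit : S Y 1 0 \is a GRing.unit.
  have [w' lead] : exists w', small 1 (word_inv w' * A 0%N 1 0 - 1).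
    have := neq_nil x 0%N; rewrite /A; case: (mkseq _ _) => // b w' _; exists w'.
    by have [_ _ -> _] := word_mx_cons b w'; have [] := word_mx_lead w'.
  have sv : small 0 (word_inv w') by apply: small_leq (@word_inv_small w') _.
  case: (@unit_of_small (word_inv w') (S Y 1 0) 0 sv) => //.
  rewrite !mxE /= addr0 mulrDr addrAC; apply: smallD => //.
  apply: (@smallM 0 1) => //; rewrite summxE; apply: small_sum => l.
  have -> : ((y l * Y ^+ (2 ^ l)) *: th (sigma d l)) 1 0 =
      (y l *: th (sigma d l)) 1 0 * Y ^+ (2 ^ l) by rewrite !mxE mulrAC.
  apply: (@smallM 1 0); last exact: small0_exp.
  case: l => [[|l] ln /=]; last by apply: small_leq (@sth _ _ _) _.
  by rewrite /sigma big_ord0 /= !mxE mulr0; exact: small0.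
have ratA j k : rational (A 0%N j k) by exact: rational_word_mx.
have ratB j k : rational (B 0%N j k) by exact: rational_word_mx.
have rat_t : rational t by exact: rational_trace.
have rat_r : rational r.
  apply/rationalM/rationalV/rationalX => //; apply: rational_trace => j k.
  by rewrite mulr2E; apply: rationalD; exact: rationalM.
have rat_th b j k : rational (th b j k).
  rewrite /th; case: b; last exact: rational_mx1.
  rewrite mxE; apply: rationalM; first exact: rationalV.
  rewrite mxE; apply: rationalD; last exact: rational_mx1.
  rewrite mxE.
  by apply: rationalM; [exact: rationalV | rewrite mxE; exact: rationalD].
have ratS j k : rational_poly_in Y (S Y j k).
  rewrite mxE; apply: rational_poly_inD.
    apply: rational_poly_inC; rewrite mxE; apply: rationalD => //.
    exact: rational_mx1.
  rewrite summxE; apply: rational_poly_in_sum => l; rewrite mxE.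
  apply: rational_poly_inM; last exact: rational_poly_inC.
  apply: rational_poly_inM; first exact/rational_poly_inC/rational_weight.
  exact/rational_poly_inX/rational_poly_in_var.
apply: (@algebraic_of_equation _ Y (y n) (S Y 0 0) (S Y 1 0)) => //.
- by rewrite -{1}(expn0 2) ltn_exp2l.
- exact: rational_weight.
- by rewrite -[LHS](addKr (S Y 0 0)) row0 addr0 laurent_oppr.
Qed.

(* Doubling structure of the iterates of sigma *)
Local Close Scope ring_scope.

Theorem corollary1p3 (W0 : seq bool) (eps : nat -> bool) (n : nat)
    (n_ge1 : (1 <= n)%N)
    (eps_periodic : forall i : nat, eps (i + n)%N = eps i)
    (k : nat) (k_ge1 : (1 <= k)%N) :
  algebraic_of_degree_le (2 ^ n) (CF (iter k sigma (pseq W0 eps))).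
Proof.
case: k k_ge1 => // k _; set x := iter k.+1 sigma _.
pose P := iter k sigma (fun _ => true).
pose delta i := sigma (pseq W0 eps) (level W0 i).
pose xb j := x j (+) P j.
have deltaS i : delta i.+1 = eps i (+) eps i.+1 by exact: sigma_pseq_level.
have xS i j : (k < i)%N -> (j < level W0 i)%N ->
    x (j + level W0 i)%N = x j (+) (delta i && P j).
  exact: iter_sigma_pseq_shift.
have PS i j : (k < i)%N -> P (j + level W0 i)%N = P j.
  move=> ki; rewrite /level -(subnK (ltnW ki)) expnD mulnA.
  exact: iter_sigma_periodic_mul.
(* [deltaS] describes delta at successor indices only, hence the offset [i0.+1]. *)
have per i0 i : delta (i0.+1 + (i + n)) = delta (i0.+1 + i).
  by rewrite addnA !addSn !deltaS -addSn !eps_periodic.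
have parity i0 : sigma (fun i => delta (i0.+1 + i)%N) n = false.
  (* The sum telescopes, and periodicity makes its two ends equal. *)
  suff -> m : sigma (fun i => delta (i0.+1 + i)%N) m = eps i0 (+) eps (i0 + m)%N.
    by rewrite eps_periodic addbb.
  elim: m => [|m IH]; first by rewrite /sigma big_ord0 addn0 addbb.
  by rewrite sigmaS IH addSn deltaS addbA addbK addnS.
have step i : (k < i)%N ->
    mkseq x (level W0 i.+1) =
      mkseq x (level W0 i) ++ mkseq (if delta i then xb else x) (level W0 i) /\
    mkseq xb (level W0 i.+1) =
      mkseq xb (level W0 i) ++ mkseq (if delta i then x else xb) (level W0 i).
  move=> ki; rewrite levelS; split; apply: mkseq_double => j jL.
    by rewrite xS //; case: (delta i); rewrite ?addbF.
  rewrite /xb xS // PS //; case: (delta i); rewrite ?addbF //=.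
  by rewrite -addbA addbb addbF.
(* Just after a level with delta = 1 the prefixes are V V' and V' V, whose matrices have equal
   traces. *)
have [[i [ki di]]|none] := pselect (exists i, (k < i)%N /\ delta i).
  have lt j : (k < i.+1 + j)%N by lia.
  apply: (@algebraic_of_doubling x xb (fun j => level W0 (i.+1 + j))
            (fun j => delta (i.+1 + j)%N)) => // [j|j|j|].
  - exact: level_gt0.
  - by rewrite addnS; have [] := step _ (lt j).
  - by rewrite addnS; have [] := step _ (lt j).
  - rewrite addn0; have [-> ->] := step _ ki; rewrite di !word_mx_cat.
    exact: mxtrace_mulC.
(* If delta vanishes at all levels beyond [k], then [x] doubles without twist and serves as its own
   companion. *)
have lt j : (k < k.+1 + j)%N by lia.
have dF j : delta (k.+1 + j)%N = false.
  by apply/negP => dj; apply: none; exists (k.+1 + j)%N.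
have stepF j : mkseq x (level W0 (k.+1 + j.+1)) =
    mkseq x (level W0 (k.+1 + j)) ++ mkseq x (level W0 (k.+1 + j)).
  by rewrite addnS; have [-> _] := step _ (lt j); rewrite dF.
apply: (@algebraic_of_doubling x x (fun j => level W0 (k.+1 + j))
          (fun j => delta (k.+1 + j)%N)) => // j.
- exact: level_gt0.
- by rewrite dF.
- by rewrite dF.
Qed.
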